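(* Let $R \geq 1$ and let $Q \subset \mathbb{R}^n$ be a unit cube parallel to the axes. Let $\mu$ be a probability measure supported on $Q$ with a log-concave density $f$ such that $$ f \left( \lambda x + (1 - \lambda) y \right) \leq R \left[ \lambda f(x) + (1 - \lambda) f(y) \right] $$ for any $0 < \lambda < 1$ and any $x, y \in Q$ for which $x - y$ is proportional to one of the standard unit vectors. Suppose that $A \subseteq \mathbb{R}^n$ is a measurable set with $\mu(A) \geq 1/2$. Then for all $t > 0$, $$ \mu \left( A + t B^n \right) \geq 1 - \exp \left(- t^2 / \alpha^2 \right), \qquad \text{where } \alpha = \alpha(R) = 3R. $$
   Context: A unit cube parallel to the axes is a translate of $(0,1)^n$ (or, equivalently, of its closure). A vector in $\mathbb{R}^n$ is proportional to one of the standard unit vectors when it has at most one non-zero entry. A non-negative function $f$ is log-concave if $-\log f$ is convex (as a function with values in $(-\infty,+\infty]$). $|\cdot|$ is the Euclidean norm, $B^n = \{x \in \mathbb{R}^n : |x| \leq 1\}$, and $A + tB^n = \{x + t y : x \in A,\ y \in B^n\}$. ''Measurable'' means Borel measurable, and densities are with respect to Lebesgue measure. *)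

(* Defs.v *)
From HB Require Import structures.
From mathcomp Require Import all_boot all_order all_algebra.
From mathcomp Require Import all_classical all_reals all_analysis.
From mathcomp Require Import measurable_realfun lra.

Set Implicit Arguments.
Unset Strict Implicit.
Unset Printing Implicit Defensive.
Import Order.TTheory GRing.Theory Num.Theory.
Import numFieldNormedType.Exports.

Local Open Scope classical_set_scope.
Local Open Scope ring_scope.

Definition borel_rV_display : measure_display.
Proof. exact: default_measure_display. Qed.

Section borel_rV.
Context {R : realType} {n : nat}.

Definition borel_rV : set (set 'rV[R]_n) := <<s @open 'rV[R]_n >>.

Let borel_rV0 : borel_rV set0.
Proof. exact: sigma_algebra0. Qed.

Let borel_rVC A : borel_rV A -> borel_rV (~` A).
Proof. exact: sigma_algebraC. Qed.

Let borel_rV_bigcup (F : (set 'rV[R]_n)^nat) :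
  (forall i, borel_rV (F i)) -> borel_rV (\bigcup_i (F i)).
Proof. exact: sigma_algebra_bigcup. Qed.

HB.instance Definition _ := @isMeasurable.Build borel_rV_display 'rV[R]_n
  borel_rV borel_rV0 borel_rVC borel_rV_bigcup.

End borel_rV.

Section measurable_rV.
Context {R : realType}.

Lemma open_rV_bigcup n (U : set 'rV[R]_n) : open U ->
  U = \bigcup_(p in [set p : 'rV[rat]_n * 'rV[rat]_n |
         [set x : 'rV[R]_n | forall i,
            ratr (p.1 0 i) < x 0 i < ratr (p.2 0 i)] `<=` U])
      [set x | forall i, ratr (p.1 0 i) < x 0 i < ratr (p.2 0 i)].
Proof.
move=> oU; apply/seteqP; split => [y Uy|y [p]/= pU yp]; last exact: pU.
have /nbhs_ballP[e /= e0 yeU] : nbhs y U by exact: open_nbhs_nbhs.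
have ha i : exists q : rat, y 0 i - e < ratr q < y 0 i.
  have /rat_in_itvoo[q] : y 0 i - e < y 0 i by rewrite ltrBlDr ltrDl.
  by rewrite in_itv/=; exists q.
have hb i : exists q : rat, y 0 i < ratr q < y 0 i + e.
  have /rat_in_itvoo[q] : y 0 i < y 0 i + e by rewrite ltrDl.
  by rewrite in_itv/=; exists q.
have [a aP] := choice ha; have [b bP] := choice hb.
exists (\row_i a i, \row_i b i) => /=; last first.
  by move=> i; rewrite !mxE; have /andP[_ ->] := aP i; have /andP[-> _] := bP i.
move=> x xab; apply: yeU; split => // j i; rewrite (ord1 j).
have := xab i; have := aP i; have := bP i; rewrite !mxE /ball/= ltr_distl.
move: (x 0 i) (y 0 i) (ratr (a i)) (ratr (b i)) => xi yi ai bi; lra.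
Qed.

Lemma measurable_coord n (i : 'I_n) :
  measurable_fun setT (fun x : 'rV[R]_n => x 0 i).
Proof.
apply: (measurability _ (RGenOpens.measurableE R)).
move=> _ [_ [a [b ->]] <-]; rewrite setTI; apply: sub_sigma_algebra.
by apply: open_comp => [x _|]; [exact: coord_continuous|exact: interval_open].
Qed.

Lemma measurable_fun_rV d (T : measurableType d) n (g : T -> 'rV[R]_n) :
  (forall i, measurable_fun setT (fun t => g t 0 i)) -> measurable_fun setT g.
Proof.
move=> mg; apply: (@measurability _ _ _ _ _ _ (@open 'rV[R]_n)) => //.
move=> _ [U oU <-]; rewrite setTI (open_rV_bigcup oU) preimage_bigcup.
rewrite bigcup_mkcond; apply: countable_bigcupT_measurable => // p.
case: ifPn => // _.
rewrite (_ : _ @^-1` _ = \bigcap_(i in [set: 'I_n])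
    (fun t => g t 0 i) @^-1` `]ratr (p.1 0 i), ratr (p.2 0 i)[); last first.
  apply/seteqP; split => t /=.
    by move=> H i _ /=; rewrite in_itv/= H.
  by move=> H i; have := H i Logic.I; rewrite /= in_itv.
apply: fin_bigcap_measurable => // i _.
by rewrite -[X in measurable X]setTI; apply: mg => //; exact: measurable_itv.
Qed.

Definition cons_rV n (p : R * 'rV[R]_n) : 'rV[R]_n.+1 :=
  row_mx (const_mx p.1 : 'rV_1) p.2.

Lemma cons_rV0 n p : @cons_rV n p 0 ord0 = p.1.
Proof.
have -> : ord0 = lshift n ord0 :> 'I_(1 + n) by exact: val_inj.
by rewrite /cons_rV (@row_mxEl _ 1 1 n) mxE.
Qed.

Lemma cons_rVS n p i : @cons_rV n p 0 (lift ord0 i) = p.2 0 i.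
Proof.
have -> : lift ord0 i = rshift 1 i :> 'I_(1 + n) by exact: val_inj.
by rewrite /cons_rV (@row_mxEr _ 1 1 n).
Qed.

Lemma measurable_cons_rV n : measurable_fun setT (@cons_rV n).
Proof.
apply: measurable_fun_rV => i; have [j ->|->] := unliftP ord0 i.
  rewrite (_ : (fun _ => _) = (fun x : 'rV[R]_n => x 0 j) \o snd); last first.
    by apply/funext => p /=; rewrite cons_rVS.
  by apply: measurableT_comp => //; exact: measurable_coord.
rewrite (_ : (fun _ => _) = fst)//.
by apply/funext => p /=; rewrite cons_rV0.
Qed.

Section lebesgue_cons.
Variables (n : nat) (m : {sigma_finite_measure set 'rV[R]_n -> \bar R}).

Definition lebesgue_cons : set 'rV[R]_n.+1 -> \bar R :=
  pushforward (@lebesgue_measure R \x m)%E (@cons_rV n).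


Let lebesgue_cons0 : lebesgue_cons set0 = 0%E.
Proof. by rewrite /lebesgue_cons /pushforward preimage_set0 measure0. Qed.

Let lebesgue_cons_ge0 A : (0 <= lebesgue_cons A)%E.
Proof. exact: (measure_ge0 (lebesgue_measure \x m)%E). Qed.

Let measurable_preimage_cons (A : set 'rV[R]_n.+1) :
  measurable A -> measurable (@cons_rV n @^-1` A).
Proof.
by move=> mA; rewrite -[X in measurable X]setTI; exact: measurable_cons_rV.
Qed.

Let lebesgue_cons_sigma_additive : semi_sigma_additive lebesgue_cons.
Proof.
move=> F mF tF mUF; rewrite /lebesgue_cons /pushforward preimage_bigcup.
apply: (measure_semi_sigma_additive
  (fun k => @cons_rV n @^-1` F k) (s := (lebesgue_measure \x m)%E)).
- by move=> k; exact: measurable_preimage_cons.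
- by move=> i j _ _ [p [Fip Fjp]]; apply: tF => //; exists (cons_rV p).
- by rewrite -preimage_bigcup; exact: measurable_preimage_cons.
Qed.

HB.instance Definition _ := isMeasure.Build _ _ _ lebesgue_cons
  lebesgue_cons0 lebesgue_cons_ge0 lebesgue_cons_sigma_additive.

Let lebesgue_cons_sigma_finite : sigma_finite setT lebesgue_cons.
Proof.
have /sigma_finiteP[G [UG ndG Goo]] :=
  sigma_finiteT (@lebesgue_measure R : {sigma_finite_measure set _ -> \bar R}).
have /sigma_finiteP[H [UH ndH Hoo]] := sigma_finiteT m.
pose F k := G k `*` H k.
have UF : [set: measurableTypeR R * 'rV[R]_n] = \bigcup_k F k.
  apply/seteqP; split => // -[x v] _.
  have [i _ Gix] : (\bigcup_k G k) x by rewrite -UG.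
  have [j _ Hjv] : (\bigcup_k H k) v by rewrite -UH.
  exists (maxn i j) => //; split => /=.
    by move: x Gix; exact/subsetPset/ndG/leq_maxl.
  by move: v Hjv; exact/subsetPset/ndH/leq_maxr.
have Foo k : measurable (F k) /\ ((@lebesgue_measure R \x m)%E (F k) < +oo)%E.
  have [mG Gk] := Goo k; have [mH Hk] := Hoo k.
  split; first exact: measurableX.
  by rewrite product_measure1E// lte_mul_pinfty// ge0_fin_numE.
pose uncons (v : 'rV[R]_n.+1) := (v 0 ord0, \row_i v 0 (lift ord0 i)).
have consK : cancel (@cons_rV n) uncons.
  move=> [x v]; rewrite /uncons cons_rV0; congr pair.
  by apply/rowP => i; rewrite mxE cons_rVS.
have muncons : measurable_fun setT uncons.
  apply/measurable_fun_pairP; split; first exact: measurable_coord.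
  apply: measurable_fun_rV => i.
  rewrite (_ : (fun _ => _) = (fun v : 'rV[R]_n.+1 => v 0 (lift ord0 i))).
    exact: measurable_coord.
  by apply/funext => v /=; rewrite mxE.
exists (fun k => uncons @^-1` F k); first by rewrite -preimage_bigcup -UF.
move=> k; have [mFk Fkoo] := Foo k; split.
  by rewrite -[X in measurable X]setTI; exact: muncons.
rewrite /lebesgue_cons /pushforward -comp_preimage.
by rewrite (_ : uncons \o _ = id)//; apply/funext => p; exact: consK.
Qed.

HB.instance Definition _ := Measure_isSigmaFinite.Build _ _ _ lebesgue_cons
  lebesgue_cons_sigma_finite.

End lebesgue_cons.

(* Lebesgue measure on R^n as the n-fold product of the one on R;
   [lebesgue_rV_box] below is the property that characterizes it. *)
Fixpoint lebesgue_rV n : {sigma_finite_measure set 'rV[R]_n -> \bar R} :=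
  match n with
  | 0 => \d_(0 : 'rV[R]_0)
  | n'.+1 => lebesgue_cons (lebesgue_rV n')
  end.

Lemma lebesgue_rV_box n (a b : 'rV[R]_n) : (forall i, a 0 i <= b 0 i) ->
  lebesgue_rV n [set x | forall i, a 0 i <= x 0 i <= b 0 i] =
  (\prod_i (b 0 i - a 0 i))%:E.
Proof.
elim: n a b => [|n IH] a b ab.
  by rewrite big_ord0 /= diracE mem_set// => -[].
pose a' := \row_i a 0 (lift ord0 i); pose b' := \row_i b 0 (lift ord0 i).
have mbox : measurable [set x : 'rV[R]_n | forall i, a' 0 i <= x 0 i <= b' 0 i].
  rewrite (_ : mkset _ = \bigcap_(i in [set: 'I_n])
      (fun x : 'rV[R]_n => x 0 i) @^-1` `[a' 0 i, b' 0 i]); last first.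
    apply/seteqP; split => x /= xab i.
      by move=> _ /=; rewrite in_itv/= xab.
    by have := xab i Logic.I; rewrite /= in_itv.
  apply: fin_bigcap_measurable => // i _.
  by rewrite -[X in measurable X]setTI; exact: measurable_coord.
rewrite big_ord_recl EFinM /= /lebesgue_cons /pushforward.
rewrite (_ : _ @^-1` _ = `[a 0 ord0, b 0 ord0]%classic `*`
    [set x : 'rV[R]_n | forall i, a' 0 i <= x 0 i <= b' 0 i]); last first.
  apply/seteqP; split => -[x v] /=.
    move=> H; split; first by have := H ord0; rewrite cons_rV0 in_itv.
    by move=> i; have := H (lift ord0 i); rewrite cons_rVS !mxE.
  rewrite in_itv/= => -[H0 H] i; have [j ->|->] := unliftP ord0 i.
    by have := H j; rewrite cons_rVS !mxE.
  by rewrite cons_rV0.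
rewrite product_measure1E//; congr (_ * _)%E.
  transitivity (@lebesgue_measure R `[a 0 ord0, b 0 ord0]); first by [].
  rewrite lebesgue_measure_itv/= lte_fin; have := ab ord0.
  by rewrite le_eqVlt => /predU1P[->|->//]; rewrite ltxx subrr.
rewrite IH; first by congr (_%:E); apply: eq_bigr => i _; rewrite !mxE.
by move=> i; rewrite !mxE.
Qed.

End measurable_rV.

Section euclidean.
Context {R : realType} {n : nat}.

Definition enorm (x : 'rV[R]_n) : R := Num.sqrt (\sum_i x 0 i ^+ 2).

Definition eball : set 'rV[R]_n := [set x | enorm x <= 1].

(* A + t B^n *)
Definition thicken (A : set 'rV[R]_n) (t : R) : set 'rV[R]_n :=
  [set x + t *: y | x in A & y in eball].

(* The cube may be the open or the closed one. *)
Definition unit_cube (Q : set 'rV[R]_n) : Prop :=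
  exists a : 'rV[R]_n,
    Q = [set a + u | u in [set u : 'rV[R]_n | forall i, 0 < u 0 i < 1]] \/
    Q = [set a + u | u in [set u : 'rV[R]_n | forall i, 0 <= u 0 i <= 1]].

(* [v] is proportional to a standard unit vector; [v = 0] is allowed. *)
Definition axis_parallel (v : 'rV[R]_n) : Prop :=
  exists (i : 'I_n) (c : R), v = c *: delta_mx 0 i.

(* [lne] is the extended logarithm, with [lne 0 = -oo]; hence [- lne (f x)%:E]
   takes its values in ]-oo, +oo] and, as both weights are positive, the
   right-hand side never involves 0 * oo or oo - oo. *)
Definition log_concave (f : 'rV[R]_n -> R) : Prop :=
  (forall x, 0 <= f x) /\
  forall (x y : 'rV[R]_n) (l : R), 0 < l < 1 ->
    (- lne (f (l *: x + (1 - l) *: y))%:E <=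
       l%:E * (- lne (f x)%:E) + (1 - l)%:E * (- lne (f y)%:E))%E.

Definition has_density (mu : set 'rV[R]_n -> \bar R) (f : 'rV[R]_n -> R) :=
  measurable_fun setT f /\
  forall A, measurable A -> mu A = (\int[lebesgue_rV n]_(x in A) (f x)%:E)%E.

End euclidean.

Section inner_measure.
Context d (T : measurableType d) (R : realType).

(* For a Borel set A, the set A + tB is the continuous image of a Borel set: it
   is analytic, hence measurable for the completion of any Borel probability
   measure, but it need not be Borel, and the value of [mu] on a non-Borel set
   is meaningless. On every set that is measurable for the completion of a
   finite measure, the completed measure is the inner measure. *)
Definition inner_measure (mu : set T -> \bar R) (S : set T) : \bar R :=
  ereal_sup [set mu C | C in [set C | measurable C /\ C `<=` S]].

Lemma inner_measureE (mu : {measure set T -> \bar R}) (S : set T) :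
  measurable S -> inner_measure mu S = mu S.
Proof.
move=> mS; apply/eqP; rewrite eq_le; apply/andP; split.
  by apply: ge_ereal_sup => _ [C [mC CS] <-]; apply: le_measure; rewrite ?inE.
by apply: ereal_sup_ubound; exists S => //; split.
Qed.

End inner_measure.

(* Main.v *)
Require Import Defs.
From mathcomp Require Import all_boot all_order all_algebra.
From mathcomp Require Import all_classical all_reals all_analysis.
From mathcomp Require Import measurable_realfun ring lra zify.
Import Order.TTheory GRing.Theory Num.Theory.
Import numFieldNormedType.Exports.
Local Open Scope classical_set_scope.
Local Open Scope ring_scope.

(* The density satisfies Maurey's property (tau) with a quadratic cost, in the
   form of a Prekopa-Leindler inequality on a box of side at most 1: if [w] is
   R-convex along the axes and midpoint log-concave, and
   [u x * v y <= w ((x + y) / 2) ^ 2 * exp (2 / (9 R) * |x - y| ^ 2)], then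
   [(\int u) * (\int v) <= (\int w) ^ 2]. Both hypotheses on [w] pass to
   marginals, so the inequality follows from dimension 1 by induction.

   In dimension 1, cut [u] and [v] into N pieces of equal mass, with end points
   [x_i] and [y_i], and put [z_i = (x_i + y_i) / 2], [p_i = (x_i - y_i) / 2].
   As [p] vanishes at both ends of the interval, the excess of the arithmetic
   mean [z_{i+1} - z_i] over the geometric mean of the lengths of the i-th
   pieces, of order [(p_{i+1} - p_i) ^ 2 / (z_{i+1} - z_i)], absorbs the factor
   [exp (c * p_i ^ 2)] by a Hardy inequality with weight [w]; the latter is
   elementary because, by R-convexity, [w z] is at most R times all the values
   of [w] on the left of [z], or R times all those on its right.

   Taking for [u] the restriction of the density to [A], and for [v] a multiple
   of its restriction to a set [B] at distance at least t from [A], one gets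
   [exp (2 t ^ 2 / (9 R)) * mu A * mu B <= 1]. *)

(** * The discrete inequalities of the one-dimensional argument *)

(** Cauchy-Schwarz inequality for the increments of [p], with the increments of [z] as weights; the
    induction adds one piece at a time. *)
Lemma sqr_increment_le {K : realType} (z p : nat -> K) (k m : nat) :
  (k <= m)%N -> (forall i, (k <= i < m)%N -> z i < z i.+1) ->
  (p m - p k) ^+ 2 <=
    (z m - z k) * \sum_(k <= i < m) (p i.+1 - p i) ^+ 2 / (z i.+1 - z i).
Proof.
move=> /subnKC <-; move: (m - k)%N => d {m}.
elim: d => [|d IH] zlt; first by rewrite addn0 big_geq// !subrr expr0n mul0r.
rewrite addnS big_nat_recr/= ?leq_addr//.
have {}IH := IH (fun i H => zlt i ltac:(lia)).
have zd : z (k + d)%N < z (k + d).+1 by apply: zlt; lia.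
have zk : z k <= z (k + d)%N.
  elim: d zlt {IH zd} => [|d IH] zlt; first by rewrite addn0.
  by rewrite addnS (le_trans (IH _))//; [move=> i ?|apply: ltW]; apply: zlt; lia.
have S0 : 0 <= \sum_(k <= i < k + d) (p i.+1 - p i) ^+ 2 / (z i.+1 - z i).
  rewrite big_nat; apply: sumr_ge0 => i ik.
  by rewrite divr_ge0 ?sqr_ge0// subr_ge0 ltW// zlt//; lia.
move: IH S0; set S := \sum_(_ <= _ < _) _.
set a := p (k + d)%N - p k; set P := z (k + d)%N - z k.
set q := z _ - z (k + d)%N.
set b := p (k + d).+1 - p (k + d)%N; set t := b / q => aPS S0.
have q0 : 0 < q by rewrite subr_gt0.
have P0 : 0 <= P by rewrite subr_ge0.
have bE : b = t * q by rewrite divfK// gt_eqF.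
have -> : p (k + d).+1 - p k = a + t * q by rewrite -bE /a /b; ring.
have -> : z (k + d).+1 - z k = P + q by rewrite /P /q; ring.
have -> : b ^+ 2 / q = t ^+ 2 * q by rewrite bE; field; rewrite gt_eqF.
(* What remains after expansion follows, once multiplied by [P], from [a ^ 2 <= P * S] and
   [(a - P * t) ^ 2 >= 0]; and [P = 0] forces [a = 0]. *)
suff : 2 * a * t <= S + P * t ^+ 2 by move: aPS q0; clear; nra.
have [P0'|P0'] := eqVneq P 0.
  have a0 : a ^+ 2 == 0 by rewrite eq_le sqr_ge0 andbT -(mul0r S) -P0'.
  move: a0; rewrite sqrf_eq0 => /eqP ->; rewrite P0'; move: S0; clear; nra.
have {}P0 : 0 < P by rewrite lt_neqAle eq_sym P0'.
rewrite -(ler_pM2l P0).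
by have := sqr_ge0 (a - P * t); move: aPS; clear; nra.
Qed.

(* [W i] is the weight of the [i]-th piece: quasi-convexity lets it be compared
   with all the weights on its left or with all those on its right, and [p] is
   summed from the corresponding end point, where it vanishes. *)
Lemma discrete_hardy {K : realType} (R : K) (N : nat) (z p W : nat -> K) :
  1 <= R -> (forall i, (i < N)%N -> z i < z i.+1) -> z N - z 0 <= 1 ->
  p 0 = 0 -> p N = 0 -> (forall i, 0 <= W i) ->
  (forall i j k, (i <= j <= k)%N -> (k < N)%N ->
     W j <= R * W i \/ W j <= R * W k) ->
  let D := \sum_(0 <= i < N) W i * ((p i.+1 - p i) ^+ 2 / (z i.+1 - z i)) in
  forall j, (j < N)%N -> W j * p j ^+ 2 <= R * D \/ W j * p j.+1 ^+ 2 <= R * D.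
Proof.
move=> R1 zlt z1 p0 pN W0 Wq D j jN.
have R0 : 0 <= R by lra.
have zmono k m : (k <= m)%N -> (m <= N)%N -> z k <= z m.
  move=> /subnKC <-; elim: (m - k)%N => [|d IH] mN; first by rewrite addn0.
  by rewrite addnS (le_trans (IH _)) ?ltW ?zlt//; lia.
(* Cauchy-Schwarz on a stretch of pieces of total length at most 1, along which [W j] moves inside
   the sum at the cost of a factor [R]. *)
have part k m : (k <= m)%N -> (m <= N)%N ->
    (forall i, (k <= i < m)%N -> W j <= R * W i) ->
    W j * (p m - p k) ^+ 2 <= R * D.
  move=> km mN Wj.
  have zkm : z m - z k <= 1.
    by have := zmono 0%N k ltac:(lia) ltac:(lia);
       have := zmono m N ltac:(lia) ltac:(lia); lra.
  have T0 i : (i < N)%N -> 0 <= (p i.+1 - p i) ^+ 2 / (z i.+1 - z i).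
    by move=> iN; rewrite divr_ge0 ?sqr_ge0// subr_ge0 ltW// zlt.
  have S0 : 0 <= \sum_(k <= i < m) (p i.+1 - p i) ^+ 2 / (z i.+1 - z i).
    by rewrite big_nat sumr_ge0// => i im; apply: T0; lia.
  have := sqr_increment_le z p k m km (fun i H => zlt i ltac:(lia)).
  move=> /le_trans/(_ (ler_wpM2r S0 zkm)); rewrite mul1r.
  move=> /(ler_wpM2l (W0 j))/le_trans; apply.
  rewrite /D (big_cat_nat (m := 0%N) (n := k) (p := N))//=; last lia.
  rewrite [X in _ + X](big_cat_nat (n := m))//= !mulrDr.
  have pos a b : (b <= N)%N ->
      0 <= R * \sum_(a <= i < b) W i * ((p i.+1 - p i) ^+ 2 / (z i.+1 - z i)).
    move=> bN; rewrite mulr_ge0// big_nat sumr_ge0// => i ib.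
    by rewrite mulr_ge0// T0//; lia.
  have le_mid (a b c d : K) : 0 <= b -> 0 <= d -> a <= c -> a <= b + (c + d) by lra.
  apply: le_mid.
  - by apply: pos; lia.
  - by apply: pos.
  rewrite !mulr_sumr big_nat [leRHS]big_nat; apply: ler_sum => i ikm.
  by rewrite mulrA ler_wpM2r// ?T0 ?Wj//; lia.
(* If [W j] is dominated by all the weights on its left, sum from 0 up to [p j.+1]. Otherwise some
   [i] on the left fails and, paired with this [i], every [k] on the right must dominate, so sum
   from [j] to [N]. *)
have [L|] := pselect (forall i, (i <= j)%N -> W j <= R * W i).
  right; have := part 0%N j.+1 erefl jN; rewrite p0 subr0; apply => i ij.
  by apply: L; lia.
move=> /existsNP[i /not_implyP[ij /negP]]; rewrite -ltNge => Wi; left.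
have := part j N (ltnW jN) (leqnn N); rewrite pN sub0r sqrrN; apply => k jk.
have [|//] := Wq i j k ltac:(lia) ltac:(lia).
by rewrite leNgt Wi.
Qed.

(** [W i] stands for the supremum of a quasi-concave function on a piece of length [D i], and [h i]
    for its integral there: this is the error of an upper Darboux sum. Away from the piece [k] of
    largest weight, the error on a piece is at most [d] times the increase of [W] from the neighbour
    further out, so each side telescopes to at most [M * d]; piece [k] costs another [M * d]. *)
Lemma darboux_unimodal {K : realType} (N : nat) (M d : K) (W D h : nat -> K) :
  (0 < N)%N -> (forall i, 0 <= W i <= M) ->
  (forall i, (i < N)%N -> 0 < D i <= d) ->
  (forall i, (i < N)%N -> 0 <= h i <= W i * D i) ->
  (forall i j k, (i <= j <= k)%N -> (k < N)%N ->
     Num.min (W i) (W k) * D j <= h j \/ i = j \/ j = k) ->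
  \sum_(0 <= i < N) W i * D i <= \sum_(0 <= i < N) h i + 3 * M * d.
Proof.
move=> N0 WM Dd hW Wmin.
have [k kN kmax] : exists2 k, (k < N)%N & forall i, (i < N)%N -> W i <= W k.
  have := @Order.TotalTheory.arg_maxP _ _ _ (Ordinal N0) predT
    (fun i : 'I_N => W i) erefl.
  move=> [k _ kmax]; exists k => // i iN.
  exact: (kmax (Ordinal iN)).
have osc i j l : (i < j < l)%N -> (l < N)%N -> Num.min (W i) (W l) <= W j.
  move=> ijl lN; have [H|[|]] := Wmin i j l ltac:(lia) lN; [|lia|lia].
  have /andP[D0 _] := Dd j ltac:(lia); rewrite -(ler_pM2r D0) (le_trans H)//.
  by have /andP[] := hW j ltac:(lia).
have left m : (m <= k)%N -> \sum_(0 <= i < m) (W i * D i - h i) <=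
    (if m is m'.+1 then W m' else 0) * d.
  elim: m => [_|m IH mk]; first by rewrite big_geq// mul0r.
  rewrite big_nat_recr//=; apply: le_trans (lerD (IH ltac:(lia)) (lexx _)) _.
  have /andP[D0 D1] := Dd m ltac:(lia); have /andP[W0 _] := WM m.
  have /andP[h0 _] := hW m ltac:(lia).
  case: m mk D0 D1 W0 h0 {IH} => [|m] mk D0 D1 W0 h0.
    by rewrite mul0r add0r; nra.
  have Wm : Num.min (W m) (W k) = W m by apply/min_idPl/kmax; lia.
  have /orP[/eqP mk'|mk'] : (m.+1 == k) || (m.+1 < k)%N by lia.
    by lia.
  have := osc m m.+1 k ltac:(lia) kN.
  have [|[]] := Wmin m m.+1 k ltac:(lia) kN; [|lia|lia].
  by rewrite Wm; nra.
(* Mirror image of [left], indexed by the number [m] of pieces counted from the right end. *)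
have right m : (k < N - m)%N -> (m < N)%N ->
    \sum_(N - m <= i < N) (W i * D i - h i) <=
    (if m is m'.+1 then W (N - m)%N else 0) * d.
  elim: m => [_|m IH mk mN]; first by rewrite subn0 big_geq// mul0r.
  rewrite big_ltn; last lia.
  rewrite (_ : (N - m.+1).+1 = (N - m)%N); last lia.
  apply: le_trans (lerD (lexx _) (IH ltac:(lia) ltac:(lia))) _.
  have jN : (N - m.+1 < N)%N by lia.
  have /andP[D0 D1] := Dd _ jN; have /andP[W0 _] := WM (N - m.+1)%N.
  have /andP[h0 _] := hW _ jN.
  case: m mk mN jN D0 D1 W0 h0 {IH} => [|m] mk mN jN D0 D1 W0 h0.
    by rewrite mul0r addr0; nra.
  have Wm : Num.min (W k) (W (N - m.+1)%N) = W (N - m.+1)%N.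
    by apply/min_idPr/kmax; lia.
  have := osc k (N - m.+2)%N (N - m.+1)%N ltac:(lia) ltac:(lia).
  have [|[]] := Wmin k (N - m.+2)%N (N - m.+1)%N ltac:(lia) ltac:(lia); [|lia|lia].
  by rewrite Wm; nra.
rewrite -lerBlDl -sumrB (big_cat_nat (n := k))//=; last lia.
rewrite [X in _ + X]big_ltn//.
have /andP[D0 D1] := Dd k kN; have /andP[Wk0 WkM] := WM k.
have /andP[h0 _] := hW k kN; have d0 : 0 < d := lt_le_trans D0 D1.
have M0 := le_trans Wk0 WkM.
have L : \sum_(0 <= i < k) (W i * D i - h i) <= M * d.
  apply: le_trans (left k (leqnn k)) _; apply: (ler_wpM2r (ltW d0)).
  by case: {+}k => [|k'] //; have /andP[] := WM k'.
have Rt : \sum_(k.+1 <= i < N) (W i * D i - h i) <= M * d.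
  have := right (N - k.+1)%N ltac:(lia) ltac:(lia).
  rewrite subKn// => /le_trans; apply; apply: (ler_wpM2r (ltW d0)).
  case: (N - k.+1)%N => [|m]; first exact: M0.
  by have /andP[] := WM k.+1.
have : W k * D k - h k <= M * d by nra.
by lra.
Qed.

(** * Transport by pieces of equal mass *)

Lemma equipartition {K : realType} (a b e M : K) (F : K -> K) (N : nat) :
  a <= b -> 0 < e ->
  (forall x y, a <= x -> x <= y -> y <= b ->
     e * (y - x) <= F y - F x <= M * (y - x)) ->
  (0 < N)%N ->
  exists x : nat -> K, [/\ x 0 = a, x N = b,
    forall i, (i <= N)%N -> a <= x i <= b &
    forall i, (i < N)%N -> x i <= x i.+1 /\
      F (x i.+1) - F (x i) = (F b - F a) / N%:R].
Proof.
move=> ab e0 Flip N0.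
have Fab : F a <= F b.
  have /andP[+ _] := Flip a b (lexx _) ab (lexx _).
  by move: ab e0; clear; nra.
have Fmono x y : a <= x <= b -> a <= y <= b -> F x <= F y -> x <= y.
  move=> /andP[ax xb] /andP[ay yb] Fxy; rewrite leNgt; apply/negP => yx.
  have /andP[+ _] := Flip y x ay (ltW yx) xb.
  by move: e0 yx Fxy; clear; nra.
have Finj x y : a <= x <= b -> a <= y <= b -> F x = F y -> x = y.
  move=> hx hy Fxy; apply/eqP; rewrite eq_le; apply/andP.
  by split; apply: Fmono => //; rewrite Fxy.
(* [F] is controlled on [[a, b]] only. Clamping its argument gives a Lipschitz function on the whole
   line, to which the intermediate value theorem applies. *)
pose cl t := Num.max a (Num.min b t).
have clab t : a <= cl t <= b.
  by rewrite /cl le_max lexx ge_max ab ge_min lexx.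
have cll t s : t <= s -> 0 <= cl s - cl t <= s - t.
  rewrite /cl => ts.
  have : 0 <= Num.min b s - Num.min b t <= s - t.
    by case: (leP b t) => ?; case: (leP b s) => ?; lra.
  move: (Num.min b s) (Num.min b t) => x y.
  by case: (leP a x) => ?; case: (leP a y) => ?; lra.
have clE t : a <= t <= b -> cl t = t.
  by case/andP=> at_ tb; rewrite /cl (min_idPr tb) (max_idPr at_).
have M1 : 0 < `|M| + 1 by rewrite ltr_wpDl.
have lip t s : `|F (cl t) - F (cl s)| <= (`|M| + 1) * `|t - s|.
  wlog ts : s t / t <= s.
    move=> H; have [/H//|/ltW/H] := leP t s.
    by rewrite distrC (distrC s).
  have /andP[h0 h1] := cll _ _ ts.
  have /andP[at_ _] := clab t; have /andP[_ sb] := clab s.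
  have /andP[k0 k1] := Flip (cl t) (cl s) at_ ltac:(lra) sb.
  have k2 : 0 <= e * (cl s - cl t) by rewrite mulr_ge0// ltW.
  rewrite (distrC t) (distrC (F _)) (@ger0_norm _ (s - t)); last by lra.
  rewrite (@ger0_norm _ (F _ - F _)); last by lra.
  by have := ler_norm M; have := normr_ge0 M; move: h0 h1 k1; clear; nra.
have cF : continuous (F \o cl).
  move=> t; apply/cvgrPdist_lt => eps eps0; near=> s.
  apply: le_lt_trans (lip _ _) _; rewrite -ltr_pdivlMl// mulrC.
  near: s; apply/nbhs_ballP; exists (eps / (`|M| + 1)) => //=.
  exact: divr_gt0.
(* Beyond [N] the witness [a] is a dummy: the claim is guarded by [i <= N]. *)
have ex i : exists t, (i <= N)%N ->
    (a <= t <= b) /\ F t = F a + i%:R / N%:R * (F b - F a).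
  have [iN|iN] := leqP i N; last by exists a => ?; lia.
  have /(IVT ab) : {within `[a, b], continuous (F \o cl)}.
    exact: continuous_subspaceT.
  rewrite /= !clE ?lexx ?ab// => /(_ (F a + i%:R / N%:R * (F b - F a))).
  have r01 : 0 <= (i%:R / N%:R : K) <= 1.
    by rewrite divr_ge0//= ler_pdivrMr ?ltr0n// mul1r ler_nat.
  rewrite (min_idPl Fab) (max_idPr Fab) => -[|t].
    by move: r01 Fab; set r := _ / _; clear; nra.
  rewrite in_itv/= => tab tE; exists t => _; split => //; rewrite -tE.
  by rewrite clE.
have [x xP] := choice ex.
have aab : a <= a <= b by rewrite lexx.
have bab : a <= b <= b by rewrite lexx ab.
have N0' : N%:R != 0 :> K by rewrite pnatr_eq0 -lt0n.
exists x; split.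
- have [x0 Fx0] := xP 0%N isT; apply: Finj => //.
  by rewrite Fx0 mul0r mul0r addr0.
- have [xN FxN] := xP N (leqnn N); apply: Finj => //.
  by rewrite FxN divff// mul1r addrC subrK.
- by move=> i /xP[].
- move=> i iN; have [xi Fxi] := xP i (ltnW iN); have [xj Fxj] := xP i.+1 iN.
  have d : F (x i.+1) - F (x i) = (F b - F a) / N%:R.
    by rewrite Fxi Fxj -natr1; field.
  split=> //; apply: Fmono => //; rewrite -subr_ge0 d divr_ge0//.
  by rewrite subr_ge0.
Unshelve. all: by end_near. Qed.

Lemma expR_le_inv {K : realType} (x : K) : x < 1 -> expR x <= (1 - x)^-1.
Proof.
move=> x1; rewrite -[x in expR x]opprK expRN lef_pV2 ?posrE ?expR_gt0//.
  exact: expR_ge1Dx.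
by rewrite subr_gt0.
Qed.

(* The gain [sqrt ((dz + dp) * (dz - dp)) <= dz - dp ^ 2 / (2 * dz)] of the
   arithmetic over the geometric mean pays for the exponential. *)
Lemma piece_bound {K : realType} (R W s dz dp q d : K) :
  1 <= R -> 0 <= W -> 0 < dz + dp -> 0 < dz - dp -> 0 <= d <= 1 ->
  `|q| <= 2^-1 ->
  s ^+ 2 <= (dz + dp) * (dz - dp) *
    (W ^+ 2 * expR (2 / (9 * R) * (2 * (`|q| + d)) ^+ 2)) ->
  s <= expR d * (W * dz - W * (dp ^+ 2 / dz) / 2 + W * q ^+ 2 / R * dz / 2).
Proof.
move=> R1 W0 dx0 dy0 /andP[d0 d1] q2 sle.
have R0 : 0 < R by lra.
have dz0 : 0 < dz by lra.
pose g := dz - dp ^+ 2 / dz / 2.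
have g0 : 0 <= g.
  rewrite /g subr_ge0 ler_pdivrMr// ler_pdivrMr//.
  by move: dx0 dy0; clear; nra.
have gg : (dz + dp) * (dz - dp) <= g ^+ 2.
  have -> : g ^+ 2 = (dz + dp) * (dz - dp) + (dp ^+ 2 / dz / 2) ^+ 2.
    by rewrite /g; field; lra.
  by rewrite lerDl sqr_ge0.
(* With this [k] the exponential of the hypothesis is the square of [expR (k * (|q| + d) ^ 2)]. The
   constant 9 is settled here: [r = k * q ^ 2] is at most 1/9, hence [1 / (1 - r) <= 1 + 9 / 8 * r],
   and [9 / 8 * r] is exactly [q ^ 2 / (2 * R)]. *)
pose k := 4 / (9 * R).
have k0 : 0 <= k by rewrite /k divr_ge0//; lra.
have k1 : k <= 4 / 9 by rewrite /k ler_pdivrMr ?mulr_gt0//; lra.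
have kR : k * R = 4 / 9 by rewrite /k; field; lra.
have qq : `|q| ^+ 2 = q ^+ 2 by rewrite real_normK// num_real.
have q0 := normr_ge0 q.
have E1 : expR (2 / (9 * R) * (2 * (`|q| + d)) ^+ 2) =
    expR (k * (`|q| + d) ^+ 2) ^+ 2.
  by rewrite -expRM_natl; congr expR; rewrite /k mulr_natl; field; lra.
have E2 : expR (k * (`|q| + d) ^+ 2) <= expR d * (1 + q ^+ 2 / R / 2).
  have -> : expR d * (1 + q ^+ 2 / R / 2) = expR d * (1 + 9 / 8 * (k * `|q| ^+ 2)).
    by rewrite qq /k; congr (_ * _); field; lra.
  (* As [|q| <= 1/2] and [d <= 1], the square [(|q| + d) ^ 2] is at most [q ^ 2 + 2 * d], and
     [2 * k * d <= d]. *)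
  have h1 : expR (k * (`|q| + d) ^+ 2) <= expR (d + k * `|q| ^+ 2).
    have h : (`|q| + d) ^+ 2 <= `|q| ^+ 2 + 2 * d.
      by move: q0 q2 d0 d1; set r := `|q|; clear; nra.
    rewrite ler_expR (le_trans (ler_wpM2l k0 h))// mulrDr addrC lerD2r.
    by have := ler_wpM2r d0 k1; lra.
  apply: le_trans h1 _; rewrite expRD ler_wpM2l ?expR_ge0//.
  have h2 : 0 <= k * `|q| ^+ 2 <= 9^-1.
    by move: q0 q2 k0 k1; clear; nra.
  have h3 : k * `|q| ^+ 2 < 1 by lra.
  apply: le_trans (expR_le_inv _ h3) _.
  rewrite -[leLHS]mul1r ler_pdivrMr; last by lra.
  by move: h2; set r := k * _; clear; nra.
have s1 : s <= W * g * expR (k * (`|q| + d) ^+ 2).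
  have r0 : 0 <= W * g * expR (k * (`|q| + d) ^+ 2).
    by rewrite !mulr_ge0// expR_ge0.
  have [s0|/ltW s0] := leP s 0; first exact: le_trans r0.
  rewrite -(ler_sqr _ _) ?nnegrE// (le_trans sle)// E1.
  rewrite !exprMn mulrA [_ * W ^+ 2]mulrC ler_wpM2r ?sqr_ge0//.
  by rewrite ler_wpM2l// sqr_ge0.
apply: le_trans s1 _.
have : W * g * expR (k * (`|q| + d) ^+ 2) <=
    W * g * (expR d * (1 + q ^+ 2 / R / 2)).
  by rewrite ler_wpM2l// mulr_ge0.
move=> /le_trans; apply; rewrite mulrCA ler_wpM2l ?expR_ge0//.
have t0 : 0 <= q ^+ 2 / R / 2 by rewrite !divr_ge0 ?sqr_ge0// ltW.
have w0 : 0 <= W * (dp ^+ 2 / dz / 2) by rewrite mulr_ge0// !divr_ge0 ?sqr_ge0// ltW.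
have -> : W * dz - W * (dp ^+ 2 / dz) / 2 + W * q ^+ 2 / R * dz / 2 =
   W * g * (1 + q ^+ 2 / R / 2) + W * (dp ^+ 2 / dz / 2) * (q ^+ 2 / R / 2).
  by rewrite /g; field; lra.
by rewrite lerDl mulr_ge0.
Qed.

(* [H] behaves as a primitive of [h] on [`[a, b]]. *)
Definition mean_value_bounds {K : realType} (a b : K) (h H : K -> K) :=
  forall x y l, a <= x -> x <= y -> y <= b ->
    ((forall s, x <= s <= y -> l <= h s) -> l * (y - x) <= H y - H x) /\
    ((forall s, x <= s <= y -> h s <= l) -> H y - H x <= l * (y - x)).

(** Only a joint bound on [u s * v t] is available, so the factors are treated in turn: for fixed
    [t], the bound [u <= B / v t] controls the increment of [F]; read as an upper bound on [v t],
    this is then integrated over [[y, y']]. The lower bound [e] permits the divisions. *)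
Lemma mean_value_mul {K : realType} (a b : K) (u v F G : K -> K)
    (x x' y y' e B : K) :
  mean_value_bounds a b u F -> mean_value_bounds a b v G -> 0 < e ->
  (forall s, a <= s <= b -> e <= u s) -> (forall s, a <= s <= b -> e <= v s) ->
  a <= x -> x < x' -> x' <= b -> a <= y -> y < y' -> y' <= b ->
  (forall s t, x <= s <= x' -> y <= t <= y' -> u s * v t <= B) ->
  (F x' - F x) * (G y' - G y) <= (x' - x) * (y' - y) * B.
Proof.
move=> Fu Gv e0 eu ev ax xx xb ay yy yb uvB.
have Fx : e * (x' - x) <= F x' - F x.
  by have [+ _] := Fu x x' e ax (ltW xx) xb; apply => s sx; apply: eu; lra.
have F0 : 0 < F x' - F x.
  by apply: lt_le_trans Fx; rewrite mulr_gt0// subr_gt0.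
have dx : 0 < x' - x by rewrite subr_gt0.
have vt t : y <= t <= y' -> v t <= B * (x' - x) / (F x' - F x).
  move=> ty; have vt0 : 0 < v t by apply: lt_le_trans e0 (ev _ _); lra.
  rewrite ler_pdivlMr// mulrC -ler_pdivlMr// mulrAC.
  have [_ +] := Fu x x' (B / v t) ax (ltW xx) xb; apply => s sx.
  by rewrite ler_pdivlMr// uvB.
have [_ /(_ vt)] := Gv y y' (B * (x' - x) / (F x' - F x)) ay (ltW yy) yb.
rewrite -(ler_pM2l F0) => /le_trans; apply.
by rewrite le_eqVlt; apply/orP; left; apply/eqP; field; rewrite gt_eqF.
Qed.

Ltac nat_lia :=
  repeat match goal with
  | H : ?T |- _ => lazymatch T with
    | nat => fail
    | is_true (leq _ _) => fail
    | is_true (andb (leq _ _) (leq _ _)) => fail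
    | is_true (negb (eq_op _ _)) => fail
    | _ => clear H
    end
  end; lia.

Lemma nondecreasing_upto {K : realType} (z : nat -> K) (N : nat) :
  (forall i, (i < N)%N -> z i <= z i.+1) ->
  forall i j, (i <= j)%N -> (j <= N)%N -> z i <= z j.
Proof.
move=> zle i j /subnKC <-; elim: (j - i)%N => [|k IH] kN; first by rewrite addn0.
by rewrite addnS (le_trans (IH _)) ?zle//; nat_lia.
Qed.

(** [W] is the supremum of [w] on each piece. It inherits from [w] the comparison up to [R] required
    by the Hardy inequality and the quasi-concavity required by the Darboux estimate. *)
Lemma upper_steps {K : realType} (a b R M : K) (w : K -> K) (z : nat -> K)
    (N : nat) :
  1 <= R -> 0 <= M ->
  (forall s, a <= s <= b -> 0 <= w s <= M) ->
  (forall x s y, a <= x -> x <= s -> s <= y -> y <= b ->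
     w x <= w s \/ w y <= w s) ->
  (forall x s y, a <= x -> x <= s -> s <= y -> y <= b ->
     w s <= R * w x \/ w s <= R * w y) ->
  (forall i, (i <= N)%N -> a <= z i <= b) ->
  (forall i, (i < N)%N -> z i <= z i.+1) ->
  exists W : nat -> K, [/\ forall i, 0 <= W i <= M,
    forall i s, (i < N)%N -> z i <= s <= z i.+1 -> w s <= W i,
    forall i j k, (i <= j <= k)%N -> (k < N)%N ->
      W j <= R * W i \/ W j <= R * W k &
    forall i j k s, (i < j < k)%N -> (k < N)%N -> z j <= s <= z j.+1 ->
      Num.min (W i) (W k) <= w s].
Proof.
move=> R1 M0 wM wconc wR zab zle.
have R0 : 0 <= R by apply: le_trans R1.
have zmono := nondecreasing_upto z N zle.
(* The value 0 beyond the last piece keeps [0 <= W i <= M] valid for all [i]. *)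
pose W i := if (i < N)%N then sup (w @` `[z i, z i.+1]) else 0.
have sab i s : (i < N)%N -> z i <= s <= z i.+1 -> a <= s <= b.
  move=> iN /andP[zs sz].
  have /andP[az _] := zab i (ltnW iN); have /andP[_ zb] := zab i.+1 iN.
  by rewrite (le_trans az)//= (le_trans sz).
have wW i s : (i < N)%N -> z i <= s <= z i.+1 -> w s <= W i.
  move=> iN sz; rewrite /W iN; apply: ub_le_sup; last first.
    by exists s => //=; rewrite in_itv.
  exists M => _ [t /=] + <-; rewrite in_itv/= => tz.
  by have /andP[] := wM t (sab i t iN tz).
have Wle i C : (i < N)%N -> (forall s, z i <= s <= z i.+1 -> w s <= C) ->
    W i <= C.
  move=> iN wC; rewrite /W iN; apply: ge_sup.
    by exists (w (z i)); exists (z i) => //=; rewrite in_itv/= lexx/= zle.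
  by move=> _ [t /=] + <-; rewrite in_itv/=; exact: wC.
have Wgt i C : (i < N)%N -> C < W i -> exists2 s, z i <= s <= z i.+1 & C < w s.
  move=> iN CW; apply: contrapT => nex; move: CW; rewrite ltNge => /negP; apply.
  apply: Wle => // s sz; rewrite leNgt; apply/negP => Cw; apply: nex.
  by exists s.
have zpiece i : (i < N)%N -> z i <= z i <= z i.+1 by move=> iN; rewrite lexx zle.
have WM i : 0 <= W i <= M.
  have [iN|iN] := ltnP i N; last by rewrite /W ltnNge iN/= lexx.
  apply/andP; split.
    have /andP[h1 _] := wM _ (sab i _ iN (zpiece i iN)).
    exact: le_trans h1 (wW i _ iN (zpiece i iN)).
  by apply: Wle => // s /(sab i s iN)/wM/andP[].
have W0 i : 0 <= W i by case/andP: (WM i).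
exists W; split=> //.
- move=> i j k /andP[ij jk] kN.
  have jN : (j < N)%N := leq_ltn_trans jk kN.
  have iN : (i < N)%N := leq_ltn_trans ij jN.
  have [|h1] := leP (W j) (R * W i); first by left.
  have [|h2] := leP (W j) (R * W k); first by right.
  (* A point [s] of piece [j] beating both bounds is compared with the outer end points [z i] and
     [z k.+1], which enclose [s] even when [i = j] or [j = k]. *)
  have [s /andP[sz zs]] := Wgt j (Num.max (R * W i) (R * W k)) jN
    ltac:(by rewrite gt_max h1 h2).
  rewrite gt_max => /andP[k1 k2]; exfalso.
  have /andP[ai _] := sab i _ iN (zpiece i iN).
  have zk : z k <= z k.+1 <= z k.+1 by rewrite lexx zle.
  have /andP[_ bk] := sab k _ kN zk.
  have is_ := le_trans (zmono i j ij (ltnW jN)) sz.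
  have sk := le_trans zs (zmono j.+1 k.+1 jk kN).
  have [m|m] := wR (z i) s (z k.+1) ai is_ sk bk.
    have := le_lt_trans (ler_wpM2l R0 (wW i _ iN (zpiece i iN))) k1.
    by rewrite ltNge m.
  have := le_lt_trans (ler_wpM2l R0 (wW k _ kN zk)) k2.
  by rewrite ltNge m.
- move=> i j k s /andP[ij jk] kN /andP[sz zs].
  have jN : (j < N)%N := ltn_trans jk kN.
  have iN : (i < N)%N := ltn_trans ij jN.
  rewrite leNgt lt_min; apply/negP => /andP[h1 h2].
  have [s1 sz1 ws1] := Wgt i _ iN h1; have [s2 sz2 ws2] := Wgt k _ kN h2.
  have /andP[a1 _] := sab i _ iN sz1; have /andP[_ b2] := sab k _ kN sz2.
  have /andP[_ s1z] := sz1; have /andP[zs2 _] := sz2.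
  have s1s := le_trans (le_trans s1z (zmono i.+1 j ij (ltnW jN))) sz.
  have ss2 := le_trans (le_trans zs (zmono j.+1 k jk (ltnW kN))) zs2.
  have [m|m] := wconc s1 s s2 a1 s1s ss2 b2.
    by rewrite ltNge m in ws1.
  by rewrite ltNge m in ws2.
Qed.

(* The pieces have length at most [M / (e * N)] since [P] increases by at most
   [M * (b - a) / N] on each of them, with slope at least [e]. *)
Lemma equipartition_short {K : realType} (a b e M : K) (h P : K -> K)
    (N : nat) :
  a < b -> b - a <= 1 -> 0 < e -> (0 < N)%N ->
  (forall s, a <= s <= b -> e <= h s <= M) -> mean_value_bounds a b h P ->
  exists x : nat -> K, [/\ x 0 = a, x N = b,
    forall i, (i <= N)%N -> a <= x i <= b &
    forall i, (i < N)%N -> 0 < x i.+1 - x i <= M / (e * N%:R) /\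
      P (x i.+1) - P (x i) = (P b - P a) / N%:R].
Proof.
move=> ab ba1 e0 N0 he hP.
have N0' : 0 < N%:R :> K by rewrite ltr0n.
have M0 : 0 < M.
  have /he/andP[h1 h2] : a <= a <= b by rewrite lexx ltW.
  exact: lt_le_trans e0 (le_trans h1 h2).
have Plip x y : a <= x -> x <= y -> y <= b ->
    e * (y - x) <= P y - P x <= M * (y - x).
  move=> ax xy yb; apply/andP; split.
    have [+ _] := hP x y e ax xy yb; apply => s /andP[xs sy].
    by have /andP[] : e <= h s <= M by apply: he; rewrite (le_trans ax)//= (le_trans sy).
  have [_ +] := hP x y M ax xy yb; apply => s /andP[xs sy].
  by have /andP[] : e <= h s <= M by apply: he; rewrite (le_trans ax)//= (le_trans sy).
have [x [x0 xN xab xP]] := equipartition a b e M P N (ltW ab) e0 Plip N0.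
exists x; split=> // i iN; have [xx PP] := xP i iN; split=> //.
have /andP[ax xb] := xab i (ltnW iN); have /andP[ax' xb'] := xab i.+1 iN.
have /andP[k1 k2] := Plip _ _ ax xx xb'.
have /andP[k3 k4] := Plip a b (lexx _) (ltW ab) (lexx _).
have PN : 0 < P (x i.+1) - P (x i).
  by rewrite PP divr_gt0//; apply: lt_le_trans k3; rewrite mulr_gt0// subr_gt0.
apply/andP; split; first by move: PN k2 M0 xx; clear; nra.
rewrite ler_pdivlMr ?mulr_gt0//.
have k5 : e * (x i.+1 - x i) <= M / N%:R.
  apply: le_trans k1 _; rewrite PP ler_pM2r ?invr_gt0//.
  by apply: le_trans k4 _; move: ba1 M0; clear; nra.
by move: k5; rewrite ler_pdivlMr//; clear; lra.
Qed.

(** The estimate for a fixed number [N] of pieces. [S] plays the geometric mean of the two masses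
    and [d] bounds the lengths of the pieces; the factor [expR d] and the term [3 * M * d] are
    discretisation errors that vanish with [d]. *)
Lemma transport_1d_step {K : realType} (a b R M e : K) (u v w F G H : K -> K)
    (N : nat) (d S : K) :
  a < b -> b - a <= 1 -> 1 <= R -> 0 < e ->
  (forall s, a <= s <= b -> e <= u s <= M) ->
  (forall s, a <= s <= b -> e <= v s <= M) ->
  (forall s, a <= s <= b -> 0 <= w s <= M) ->
  (forall x s y, a <= x -> x <= s -> s <= y -> y <= b ->
     w x <= w s \/ w y <= w s) ->
  (forall x s y, a <= x -> x <= s -> s <= y -> y <= b ->
     w s <= R * w x \/ w s <= R * w y) ->
  (forall x y, a <= x <= b -> a <= y <= b ->
     u x * v y <= w ((x + y) / 2) ^+ 2 * expR (2 / (9 * R) * (x - y) ^+ 2)) ->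
  mean_value_bounds a b u F -> mean_value_bounds a b v G ->
  mean_value_bounds a b w H ->
  S ^+ 2 = (F b - F a) * (G b - G a) ->
  (0 < N)%N -> M / (e * N%:R) <= d -> d <= 1 ->
  S <= expR d * (H b - H a + 3 * M * d).
Proof.
move=> ab ba1 R1 e0 ue ve wM wconc wR uvw uF vG wH SE N0 Nd d1.
have R0 : 0 < R := lt_le_trans ltr01 R1.
have M0 : 0 < M.
  have /ue/andP[h1 h2] : a <= a <= b by rewrite lexx ltW.
  exact: lt_le_trans e0 (le_trans h1 h2).
have N0' : 0 < N%:R :> K by rewrite ltr0n.
have [x [x0 xN xab xP]] := equipartition_short a b e M u F N ab ba1 e0 N0 ue uF.
have [y [y0 yN yab yP]] := equipartition_short a b e M v G N ab ba1 e0 N0 ve vG.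
have d0 : 0 < d.
  by apply: lt_le_trans Nd; rewrite divr_gt0// mulr_gt0.
pose z i := (x i + y i) / 2; pose p i := (x i - y i) / 2.
have z0 : z 0%N = a by rewrite /z x0 y0; clear; lra.
have zN : z N = b by rewrite /z xN yN; clear; lra.
have p0 : p 0%N = 0 by rewrite /p x0 y0 subrr mul0r.
have pN : p N = 0 by rewrite /p xN yN subrr mul0r.
have zab i : (i <= N)%N -> a <= z i <= b.
  by move=> iN; move: (xab i iN) (yab i iN); rewrite /z; clear; lra.
have zlt i : (i < N)%N -> 0 < z i.+1 - z i <= d.
  move=> iN; move: (xP i iN) (yP i iN) => [h1 _] [h2 _].
  by move: h1 h2 Nd; rewrite /z; clear; lra.
have zle i : (i < N)%N -> z i <= z i.+1.
  by move=> /zlt/andP[h _]; rewrite -subr_ge0 ltW.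
have [W [WM wW WR Wmin]] :=
  upper_steps a b R M w z N R1 (ltW M0) wM wconc wR zab zle.
have W0 i : 0 <= W i by case/andP: (WM i).
pose h i := H (z i.+1) - H (z i).
have hW i l : (i < N)%N -> (forall s, z i <= s <= z i.+1 -> l <= w s) ->
    l * (z i.+1 - z i) <= h i.
  move=> iN lw; have [+ _] := wH (z i) (z i.+1) l
    (proj1 (andP (zab i (ltnW iN)))) (zle i iN) (proj2 (andP (zab i.+1 iN))).
  exact.
have hW' i : (i < N)%N -> h i <= W i * (z i.+1 - z i).
  move=> iN; have [_ +] := wH (z i) (z i.+1) (W i)
    (proj1 (andP (zab i (ltnW iN)))) (zle i iN) (proj2 (andP (zab i.+1 iN))).
  by apply => s; exact: wW.
have darboux : \sum_(0 <= i < N) W i * (z i.+1 - z i) <= H b - H a + 3 * M * d.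
  have -> : H b - H a = \sum_(0 <= i < N) h i.
    by rewrite (telescope_sumr (fun i => H (z i)))// z0 zN.
  apply: darboux_unimodal => //.
    move=> i iN; rewrite hW'// andbT.
    rewrite -(mul0r (z i.+1 - z i)) hW// => s /andP[zs sz].
    have /andP[az _] := zab i (ltnW iN); have /andP[_ zb] := zab i.+1 iN.
    by have /wM/andP[] : a <= s <= b by rewrite (le_trans az)//= (le_trans sz).
  move=> i j k ijk kN; have [->|ij] := eqVneq i j; first by right; left.
  have [->|jk] := eqVneq j k; first by right; right.
  have ij' : (i < j < k)%N by nat_lia.
  by left; apply: hW => [|s sz]; [nat_lia|exact: Wmin sz].
pose D := \sum_(0 <= i < N) W i * ((p i.+1 - p i) ^+ 2 / (z i.+1 - z i)).
have zlt' i : (i < N)%N -> z i < z i.+1 by move=> /zlt/andP[+ _]; rewrite subr_gt0.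
have zN1 : z N - z 0%N <= 1 by rewrite z0 zN.
have hardy := discrete_hardy R N z p W R1 zlt' zN1 p0 pN W0 WR.
have piece i : (i < N)%N -> S / N%:R <= expR d * (W i * (z i.+1 - z i) -
    W i * ((p i.+1 - p i) ^+ 2 / (z i.+1 - z i)) / 2 +
    D * (z i.+1 - z i) / 2).
  move=> iN.
  have [/andP[dx0 dx1] Fx] := xP i iN; have [/andP[dy0 dy1] Gy] := yP i iN.
  have /andP[ax xb] := xab i (ltnW iN); have /andP[ax' xb'] := xab i.+1 iN.
  have /andP[ay yb] := yab i (ltnW iN); have /andP[ay' yb'] := yab i.+1 iN.
  have dz0 : 0 < z i.+1 - z i by case/andP: (zlt i iN).
  (* [q] is whichever of [p i] and [p i.+1] the Hardy inequality controls; [W i * q ^ 2 / R] is then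
     at most [D]. *)
  have q_bound q : q = p i \/ q = p i.+1 -> W i * q ^+ 2 <= R * D ->
      S / N%:R <= expR d * (W i * (z i.+1 - z i) -
      W i * ((p i.+1 - p i) ^+ 2 / (z i.+1 - z i)) / 2 +
      D * (z i.+1 - z i) / 2).
    move=> qp WqD.
    have q2 : `|q| <= 2^-1.
      rewrite ler_norml; move: xb ax xb' ax' yb ay yb' ay' ba1 qp.
      by rewrite /p; clear => ? ? ? ? ? ? ? ? ? [] ->; lra.
    (* On the two pieces the difference [s - t] stays within [2 * d] of [2 * q]. *)
    have qd s t : x i <= s <= x i.+1 -> y i <= t <= y i.+1 ->
        (s - t) ^+ 2 <= (2 * (`|q| + d)) ^+ 2.
      move=> sx ty; rewrite -[leLHS]real_normK ?num_real//.
      have r0 : 0 <= 2 * (`|q| + d) by rewrite mulr_ge0// addr_ge0// ltW.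
      rewrite ler_sqr ?nnegrE//.
      rewrite ler_norml; have := ler_norm (- q); have := ler_norm q.
      move: sx ty dx1 dy1 Nd qp; rewrite normrN /p; move: `|q|; clear.
      by move=> r ? ? ? ? ? [] -> ? ?; lra.
    have Sle : (S / N%:R) ^+ 2 <= ((z i.+1 - z i) + (p i.+1 - p i)) *
        ((z i.+1 - z i) - (p i.+1 - p i)) *
        (W i ^+ 2 * expR (2 / (9 * R) * (2 * (`|q| + d)) ^+ 2)).
      have -> : z i.+1 - z i + (p i.+1 - p i) = x i.+1 - x i.
        by rewrite /z /p; clear; lra.
      have -> : z i.+1 - z i - (p i.+1 - p i) = y i.+1 - y i.
        by rewrite /z /p; clear; lra.
      have -> : (S / N%:R) ^+ 2 =
          (F (x i.+1) - F (x i)) * (G (y i.+1) - G (y i)).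
        by rewrite Fx Gy expr_div_n SE; field; rewrite gt_eqF.
      apply: (mean_value_mul a b u v F G _ _ _ _ e) => //.
      - by move=> s /ue/andP[].
      - by move=> s /ve/andP[].
      - by rewrite -subr_gt0.
      - by rewrite -subr_gt0.
      move=> s t sx ty; 
      have sab : a <= s <= b by move: ax xb' sx; clear; lra.
      have tab : a <= t <= b by move: ay yb' ty; clear; lra.
      apply: le_trans (uvw s t sab tab) _.
      have st : z i <= (s + t) / 2 <= z i.+1 by move: sx ty; rewrite /z; clear; lra.
      have /wM/andP[w0 _] : a <= (s + t) / 2 <= b by move: sab tab; clear; lra.
      rewrite ler_pM ?expR_ge0 ?sqr_ge0//.
        by rewrite ler_sqr ?nnegrE// wW.
      by rewrite ler_expR ler_wpM2l ?qd// divr_ge0// mulr_ge0// ltW.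
    apply: le_trans (piece_bound R (W i) _ _ _ q d R1 (W0 i) _ _ _ q2 Sle) _.
    - by move: dx0; rewrite /z /p; clear; lra.
    - by move: dy0; rewrite /z /p; clear; lra.
    - by rewrite ltW.
    rewrite ler_wpM2l ?expR_ge0// lerD2l ler_pM2r// ler_wpM2r//; first exact: ltW.
    by rewrite ler_pdivrMr// [leRHS]mulrC.
  by have [] := hardy i iN; apply: q_bound; [left|right].
have -> : S = \sum_(0 <= i < N) S / N%:R.
  by rewrite sumr_const_nat subn0 -[RHS]mulr_natr divfK// gt_eqF.
have := ler_sum_nat (fun i (iN : (0 <= i < N)%N) => piece i (proj2 (andP iN))).
move=> /le_trans; apply; rewrite -mulr_sumr ler_wpM2l ?expR_ge0//.
apply: le_trans darboux.
(* The terms in [D] add up to [- D / 2 + D * (z N - z 0) / 2], which is nonpositive because the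
   interval has length at most 1. *)
rewrite big_split/= sumrB -!mulr_suml -/D -mulr_sumr (telescope_sumr z)//.
have D0 : 0 <= D.
  rewrite /D big_nat sumr_ge0// => i iN; rewrite mulr_ge0// divr_ge0 ?sqr_ge0//.
  by have := zlt' i (proj2 (andP iN)); clear; lra.
by move: zN1 D0; set T := \sum_(_ <= _ < _) _; clear; nra.
Qed.

Lemma transport_1d {K : realType} (a b R M e : K) (u v w F G H : K -> K) :
  a < b -> b - a <= 1 -> 1 <= R -> 0 < e ->
  (forall s, a <= s <= b -> e <= u s <= M) ->
  (forall s, a <= s <= b -> e <= v s <= M) ->
  (forall s, a <= s <= b -> 0 <= w s <= M) ->
  (forall x s y, a <= x -> x <= s -> s <= y -> y <= b ->
     w x <= w s \/ w y <= w s) ->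
  (forall x s y, a <= x -> x <= s -> s <= y -> y <= b ->
     w s <= R * w x \/ w s <= R * w y) ->
  (forall x y, a <= x <= b -> a <= y <= b ->
     u x * v y <= w ((x + y) / 2) ^+ 2 * expR (2 / (9 * R) * (x - y) ^+ 2)) ->
  mean_value_bounds a b u F -> mean_value_bounds a b v G ->
  mean_value_bounds a b w H ->
  (F b - F a) * (G b - G a) <= (H b - H a) ^+ 2.
Proof.
move=> ab ba1 R1 e0 ue ve wM wconc wR uvw uF vG wH.
have ge0 h P l : 0 <= l -> (forall s, a <= s <= b -> l <= h s) ->
    mean_value_bounds a b h P -> 0 <= P b - P a.
  move=> l0 lh hP; have [+ _] := hP a b l (lexx _) (ltW ab) (lexx _).
  by move=> /(_ lh)/(le_trans _); apply; rewrite mulr_ge0// subr_ge0 ltW.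
have F0 : 0 <= F b - F a by apply: (ge0 u _ e _ _ uF) => [|s /ue/andP[]]; lra.
have G0 : 0 <= G b - G a by apply: (ge0 v _ e _ _ vG) => [|s /ve/andP[]]; lra.
have H0 : 0 <= H b - H a by apply: (ge0 w _ 0 _ _ wH) => [|s /wM/andP[]]; lra.
have M0 : 0 < M.
  by have /andP[h1 h2] := ue a ltac:(lra); apply: lt_le_trans e0 _; lra.
have FG0 := mulr_ge0 F0 G0.
pose S := Num.sqrt ((F b - F a) * (G b - G a)).
have SE : S ^+ 2 = (F b - F a) * (G b - G a) by rewrite sqr_sqrtr.
rewrite -SE ler_sqr ?nnegrE ?sqrtr_ge0//.
rewrite leNgt; apply/negP => HS; have S0 : 0 <= S by exact: sqrtr_ge0.
(* Since [expR t <= 1 / (1 - t)], a contradiction needs [H b - H a + 3 * M * t < S * (1 - t)]; the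
   extra 1 in the denominator makes this strict. *)
pose t := Num.min (2^-1) ((S - (H b - H a)) / (S + 3 * M + 1)).
have den : 0 < S + 3 * M + 1 by lra.
have t0 : 0 < t.
  by rewrite lt_min invr_gt0 ltr0n/=; apply: divr_gt0; rewrite ?subr_gt0.
have t2 : t <= 2^-1 by rewrite ge_min lexx.
have tS : t * (S + 3 * M + 1) <= S - (H b - H a).
  by rewrite -ler_pdivlMr// ge_min lexx orbT.
have Met : 0 <= M / (e * t) by rewrite divr_ge0 ?mulr_ge0// ltW.
have := archi_boundP Met; set N := Num.Def.archi_bound _ => MN.
have N0 : 0 < N%:R :> K by exact: le_lt_trans MN.
have Nt : M / (e * N%:R) <= t.
  move: MN; rewrite !ltr_pdivrMr ?mulr_gt0// => MN.
  by rewrite ler_pdivrMr ?mulr_gt0//; lra.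
have := transport_1d_step a b R M e u v w F G H N t S
  ab ba1 R1 e0 ue ve wM wconc wR uvw uF vG wH SE ltac:(by rewrite -(ltr0n K))
  Nt ltac:(lra).
rewrite leNgt => /negP; apply.
have E : expR t <= (1 - t)^-1 by apply: expR_le_inv; lra.
apply: le_lt_trans (ler_wpM2r _ E) _.
  by rewrite addr_ge0// !mulr_ge0// ltW.
by rewrite mulrC ltr_pdivrMr; lra.
Qed.

(** * The one-dimensional inequality *)

Lemma mean_value_bounds_addC {K : realType} (a b c : K) (h H : K -> K) :
  mean_value_bounds a b h H ->
  mean_value_bounds a b (fun t => h t + c) (fun t => H t + c * t).
Proof.
move=> hH x y l ax xy yb; have [lo up] := hH x y (l - c) ax xy yb; split=> hl.
  have /lo : forall s, x <= s <= y -> l - c <= h s.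
    by move=> s /hl; rewrite lerBlDr.
  by clear; lra.
have /up : forall s, x <= s <= y -> h s <= l - c.
  by move=> s /hl; rewrite lerBrDr.
by clear; lra.
Qed.

Lemma bounded_integrable {K : realType} d (T : measurableType d)
    (mu : {measure set T -> \bar K}) (h : T -> K) (M : K) (A : set T) :
  measurable A -> (mu A < +oo)%E -> measurable_fun setT h ->
  (forall x, A x -> `|h x| <= M) -> mu.-integrable A (EFin \o h).
Proof.
move=> mA Aoo mh hM; apply: measurable_bounded_integrable => //.
  exact: measurable_funS mh.
exists M; split; first exact: num_real.
by move=> N MN x Ax /=; rewrite (le_trans (hM x Ax))// ltW.
Qed.

(** [h] is merely measurable and bounded, so bounds on the increments of its indefinite integral
    take the place of differentiability. *)
Lemma primitive_mean_value {K : realType} (a b M : K) (h : K -> K) :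
  a <= b -> measurable_fun setT h -> (forall s, a <= s <= b -> 0 <= h s <= M) ->
  exists P : K -> K, mean_value_bounds a b h P /\
    P b - P a = \int[lebesgue_measure]_(s in `[a, b]) h s.
Proof.
move=> ab mh hM.
have integ x y (i : bool) : a <= x -> y <= b ->
    lebesgue_measure.-integrable [set` Interval (BSide i x) (BRight y)]
      (EFin \o h).
  move=> ax yb; apply: (bounded_integrable _ _ _ _ M) => //.
    by rewrite /= lebesgue_measure_itv/=; case: ifP => _; rewrite ltry.
  move=> s /=; rewrite in_itv/= => /andP[xs sy].
  have xs' : x <= s by case: i xs => [//|/ltW].
  have /hM/andP[h0 h1] : a <= s <= b by rewrite (le_trans ax)//= (le_trans sy).
  by rewrite ger0_norm.
pose P t := \int[lebesgue_measure]_(s in `[a, t]) h s.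
have PB x y : a <= x -> x <= y -> y <= b ->
    P y - P x = \int[lebesgue_measure]_(s in `]x, y]) h s.
  by move=> ax xy yb; rewrite /P Rintegral_itvB ?bnd_simp//; exact: integ.
exists P; split.
  move=> x y l ax xy yb; rewrite PB//.
  have cst : \int[lebesgue_measure]_(s in `]x, y]) l = l * (y - x).
    rewrite Rintegral_cst//= lebesgue_measure_itv/= lte_fin.
    by move: xy; rewrite le_eqVlt => /predU1P[->|->//]; rewrite ltxx subrr.
  have intl : lebesgue_measure.-integrable `]x, y] (EFin \o fun=> l).
    apply: (bounded_integrable _ _ _ _ `|l|) => //.
    by rewrite /= lebesgue_measure_itv/=; case: ifP => _; rewrite ltry.
  split=> hl; rewrite -cst; apply: le_Rintegral => //; try exact: integ.
    by move=> s /=; rewrite in_itv/= => /andP[/ltW xs sy]; apply: hl; rewrite xs.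
  by move=> s /=; rewrite in_itv/= => /andP[/ltW xs sy]; apply: hl; rewrite xs.
by rewrite PB// Rintegral_itv_obnd_cbnd//; exact: integ.
Qed.

(* Repeated bisection of [`[x, y]], keeping [s] and end points in [D]. *)
Lemma midpoint_dense {K : realType} (D : K -> Prop) (x s y eps : K) :
  (forall t t', x <= t -> t <= t' -> t' <= y -> D t -> D t' ->
     D ((t + t') / 2)) ->
  D x -> D y -> x <= s -> s <= y -> 0 < eps ->
  exists d, [/\ D d, s <= d, d <= y & d <= s + eps].
Proof.
move=> Dmid Dx Dy xs sy eps0.
have bis k : exists t t', [/\ D t, D t', x <= t <= s, s <= t' <= y &
    t' - t <= (y - x) / 2 ^+ k].
  elim: k => [|k [t [t' [Dt Dt' tx t'y tt']]]].
    by exists x, y; split; rewrite ?xs ?sy ?lexx ?expr0 ?divr1.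
  have Dm : D ((t + t') / 2).
    by apply: Dmid => //; move: tx t'y; clear; lra.
  have half : (y - x) / 2 ^+ k.+1 = (y - x) / 2 ^+ k / 2.
    by rewrite exprSr invfM mulrA.
  have [ms|sm] := leP ((t + t') / 2) s.
    by exists ((t + t') / 2), t'; rewrite half; split=> //;
      move: ms tx t'y tt'; clear; lra.
  by exists t, ((t + t') / 2); rewrite half; split=> //;
    move: sm tx t'y tt'; clear; lra.
have yx : 0 <= (y - x) / eps.
  by rewrite divr_ge0// ?(ltW eps0)// subr_ge0 (le_trans xs).
have := archi_boundP yx; set k := Num.Def.archi_bound _ => yxk.
have [t [t' [Dt Dt' tx t'y tt']]] := bis k; exists t'; split=> //.
- by case/andP: t'y.
- by case/andP: t'y.
have : (y - x) / 2 ^+ k <= eps.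
  rewrite ler_pdivrMr ?exprn_gt0// mulrC -ler_pdivrMr// (le_trans (ltW yxk))//.
  by rewrite -natrX ler_nat ltnW// ltn_expl.
by move: tx tt'; clear; lra.
Qed.

(* Let [i] be the infimum of [w] on [`[x, y]], and suppose that
   [0 < i < m = min (w x) (w y)]. If [w s ^ 2 < i * m], reflecting at [s] a
   nearby point [d] where [m <= w d] gives [w (2 * s - d) < i]. *)
Lemma midpoint_quasi_concave {K : realType} (a b R : K) (w : K -> K) :
  1 <= R -> (forall s, a <= s <= b -> 0 <= w s) ->
  (forall x y, a <= x <= b -> a <= y <= b ->
     w x * w y <= w ((x + y) / 2) ^+ 2) ->
  (forall x y l, a <= x <= b -> a <= y <= b -> 0 < l < 1 ->
     w (l * x + (1 - l) * y) <= R * (l * w x + (1 - l) * w y)) ->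
  forall x s y, a <= x -> x <= s -> s <= y -> y <= b ->
    w x <= w s \/ w y <= w s.
Proof.
move=> R1 w0 wmid wR x s0 y ax xs0 s0y yb.
have R0 : 0 < R := lt_le_trans ltr01 R1.
have wab t : x <= t <= y -> a <= t <= b.
  by move=> /andP[xt ty]; rewrite (le_trans ax)//= (le_trans ty).
pose m := Num.min (w x) (w y).
suff : m <= w s0 by rewrite ge_min => /orP[]; [left|right].
have mx : m <= w x by rewrite ge_min lexx.
have my : m <= w y by rewrite ge_min lexx orbT.
have xy : x <= y := le_trans xs0 s0y.
have ws0 : 0 <= w s0 by apply: w0; apply: wab; rewrite xs0.
have [m0|m0] := leP m 0; first exact: le_trans ws0.
rewrite leNgt; apply/negP => ws0m.
have dense s eps : x <= s -> s <= y -> 0 < eps ->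
    exists d, [/\ m <= w d, s <= d, d <= y & d <= s + eps].
  move=> xs sy; apply: (midpoint_dense (fun t => m <= w t) x s y eps) => //.
  move=> t t' xt tt' ty mt mt'.
  have tab : a <= t <= b by apply: wab; rewrite xt (le_trans tt').
  have tab' : a <= t' <= b by apply: wab; rewrite ty (le_trans xt).
  have mid : 0 <= w ((t + t') / 2).
    by apply: w0; move: tab tab'; clear; lra.
  rewrite -(ler_sqr (ltW m0) mid) (le_trans _ (wmid t t' tab tab'))//.
  by rewrite expr2 ler_pM// ltW.
(* Comparison with [d] slightly larger than [s], in terms of [w s] and [w y]. *)
have lower s : x <= s -> s <= y -> m <= R * w s.
  move=> xs sy; rewrite leNgt; apply/negP => Rws.
  have sab : a <= s <= b by apply: wab; rewrite xs.
  have yab : a <= y <= b by apply: wab; rewrite xy lexx.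
  have ws : 0 <= w s by apply: w0.
  have wy : 0 < w y by exact: lt_le_trans my.
  have sy' : s < y.
    rewrite lt_neqAle sy andbT; apply/eqP => E.
    by move: Rws my R1 wy; rewrite E; clear; nra.
  (* Chosen so that the weight [1 - l] of [y] in [d] contributes at most half of the gap
     [m - R * w s], whence [w d < m]. *)
  pose eps := (m - R * w s) / (R * w y) / 2 * (y - s).
  have gap : 0 < (m - R * w s) / (R * w y) / 2.
    by rewrite divr_gt0// divr_gt0 ?mulr_gt0// subr_gt0.
  have eps0 : 0 < eps by rewrite mulr_gt0// subr_gt0.
  have [d [md sd dy ds]] := dense s eps xs sy eps0.
  have [E|sd'] := eqVneq s d.
    by move: Rws md R1 ws; rewrite -E; clear; nra.
  have [E|dy'] := eqVneq d y.
    have : y - s <= eps by rewrite -E; move: ds; clear; lra.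
    rewrite /eps -[leLHS]mul1r ler_pM2r ?subr_gt0//.
    rewrite ler_pdivlMr// mul1r ler_pdivlMr ?mulr_gt0//.
    by move: my R1 ws wy R0; clear; nra.
  have {}sd' : s < d by rewrite lt_neqAle sd' sd.
  have {}dy' : d < y by rewrite lt_neqAle dy' dy.
  pose l := (y - d) / (y - s).
  have ys : 0 < y - s by rewrite subr_gt0.
  have l01 : 0 < l < 1.
    by rewrite divr_gt0 ?subr_gt0//= ltr_pdivrMr// mul1r; move: sd'; clear; lra.
  have dE : d = l * s + (1 - l) * y.
    by rewrite /l; field; rewrite gt_eqF.
  have := wR s y l sab yab l01; rewrite -dE => /(le_trans md).
  have l1 : 1 - l <= (m - R * w s) / (R * w y) / 2.
    have -> : 1 - l = (d - s) / (y - s) by rewrite /l; field; rewrite gt_eqF.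
    by rewrite ler_pdivrMr//; move: ds; rewrite /eps; clear; lra.
  have {}l1 : (1 - l) * (R * w y) <= (m - R * w s) / 2.
    move: l1; rewrite mulrAC ler_pdivlMr ?mulr_gt0//.
  have : l * (R * w s) <= R * w s.
    by rewrite ler_piMl ?mulr_ge0// ?(ltW R0)//; case/andP: l01 => _ /ltW.
  by move: l1 Rws; clear; lra.
pose E := w @` `[x, y].
have E0 : E !=set0 by exists (w x); exists x => //=; rewrite in_itv/= lexx.
have Elb : has_lbound E.
  exists 0 => _ [t /=] + <-; rewrite in_itv/= => /wab; exact: w0.
pose i := inf E.
have iw t : x <= t <= y -> i <= w t.
  by move=> txy; apply: ge_inf => //; exists t => //=; rewrite in_itv.
(* By [lower], [w] stays above [m / R] on [[x, y]]. *)
have i0 : 0 < i.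
  apply: (@lt_le_trans _ _ (m / R)); first by rewrite divr_gt0.
  apply: lb_le_inf => // _ [t /=] + <-; rewrite in_itv/= => /andP[xt ty].
  by rewrite ler_pdivrMr// mulrC lower.
have im : i < m by apply: le_lt_trans ws0m; apply: iw; rewrite xs0.
have isq : i < Num.sqrt (i * m).
  rewrite -[ltLHS]ger0_norm ?(ltW i0)// -sqrtr_sqr ltr_sqrt ?mulr_gt0//.
  by rewrite expr2 ltr_pM2l.
have [_ [s /=] + <- ws] := inf_lt E0 isq; rewrite in_itv/=.
move=> /andP[xs sy].
have sab : a <= s <= b by apply: wab; rewrite xs.
have ws2 : w s ^+ 2 < i * m.
  rewrite -[ltRHS]sqr_sqrtr ?mulr_ge0 ?(ltW i0) ?(ltW m0)//.
  by rewrite ltr_sqr ?nnegrE ?sqrtr_ge0// w0.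
have wsm : w s < m.
  rewrite -ltr_sqr ?nnegrE ?(ltW m0) ?w0//; apply: lt_trans ws2 _.
  by rewrite expr2 ltr_pM2r.
have xs' : x < s.
  by rewrite lt_neqAle xs andbT; apply/eqP => Es; move: wsm; rewrite -Es ltNge mx.
(* The radius [s - x] keeps the reflected point [2 * s - d] to the right of [x]. *)
have [d [md sd dy ds]] := dense s (s - x) xs sy ltac:(by rewrite subr_gt0).
have dab : a <= d <= b by apply: wab; rewrite dy (le_trans xs).
have rxy : x <= 2 * s - d <= y by move: sd ds sy; clear; lra.
have := wmid d (2 * s - d) dab (wab _ rxy).
have -> : (d + (2 * s - d)) / 2 = s by clear; lra.
move=> H; have := le_lt_trans H ws2; rewrite ltNge mulrC => /negP; apply.
by rewrite ler_pM ?iw// ltW.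
Qed.

(** Midpoint log-concavity and [R]-convexity are first reduced to quasi-concavity and comparison up
    to [R], which survive the addition of a constant. Adding [e] to [u] and [v], and [n] to [w],
    provides the positive lower bound that [transport_1d] asks for; then [n] tends to 0. *)
Lemma prekopa_1d {K : realType} (a b R M : K) (u v w : K -> K) :
  a < b -> b - a <= 1 -> 1 <= R ->
  measurable_fun setT u -> measurable_fun setT v -> measurable_fun setT w ->
  (forall s, a <= s <= b -> 0 <= u s <= M) ->
  (forall s, a <= s <= b -> 0 <= v s <= M) ->
  (forall s, a <= s <= b -> 0 <= w s <= M) ->
  (forall x y, a <= x <= b -> a <= y <= b ->
     w x * w y <= w ((x + y) / 2) ^+ 2) ->
  (forall x y l, a <= x <= b -> a <= y <= b -> 0 < l < 1 ->
     w (l * x + (1 - l) * y) <= R * (l * w x + (1 - l) * w y)) ->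
  (forall x y, a <= x <= b -> a <= y <= b ->
     u x * v y <= w ((x + y) / 2) ^+ 2 * expR (2 / (9 * R) * (x - y) ^+ 2)) ->
  (\int[lebesgue_measure]_(s in `[a, b]) u s) *
  (\int[lebesgue_measure]_(s in `[a, b]) v s) <=
  (\int[lebesgue_measure]_(s in `[a, b]) w s) ^+ 2.
Proof.
move=> ab ba1 R1 mu mv mw uM vM wM wmid wR uvw.
have R0 : 0 < R := lt_le_trans ltr01 R1.
have w0 s : a <= s <= b -> 0 <= w s by move=> /wM/andP[].
have wconc := midpoint_quasi_concave a b R w R1 w0 wmid wR.
have wquasi x s y : a <= x -> x <= s -> s <= y -> y <= b ->
    w s <= R * w x \/ w s <= R * w y.
  move=> ax xs sy yb.
  have xab : a <= x <= b by rewrite ax (le_trans xs)// (le_trans sy).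
  have yab : a <= y <= b by rewrite yb (le_trans ax)// (le_trans xs).
  have [E|xs'] := eqVneq x s.
    by left; rewrite -E ler_peMl// w0.
  have [E|sy'] := eqVneq s y.
    by right; rewrite E ler_peMl// w0.
  have {}xs' : x < s by rewrite lt_neqAle xs' xs.
  have {}sy' : s < y by rewrite lt_neqAle sy' sy.
  have yx : 0 < y - x by rewrite subr_gt0 (lt_trans xs').
  have xy_ : x < y by rewrite -subr_gt0.
  pose l := (y - s) / (y - x).
  have l01 : 0 < l < 1.
    rewrite /l divr_gt0 ?yx ?subr_gt0//= ltr_pdivrMr// mul1r.
    by move: xs'; clear; lra.
  have := wR x y l xab yab l01.
  have -> : l * x + (1 - l) * y = s by rewrite /l; field; rewrite gt_eqF.
  have [xy H|/ltW yx' H] := leP (w x) (w y).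
    right; apply: le_trans H _; rewrite ler_pM2l//.
    by move: l01 xy; clear; nra.
  left; apply: le_trans H _; rewrite ler_pM2l//.
  by move: l01 yx'; clear; nra.
have [F [uF <-]] := primitive_mean_value a b M u (ltW ab) mu uM.
have [G [vG <-]] := primitive_mean_value a b M v (ltW ab) mv vM.
have [H [wH <-]] := primitive_mean_value a b M w (ltW ab) mw wM.
have M0 : 0 <= M.
  by have /uM/andP[h1 h2] : a <= a <= b; [rewrite lexx ltW|exact: le_trans h1 h2].
have ge0 h P : (forall s, a <= s <= b -> 0 <= h s <= M) ->
    mean_value_bounds a b h P -> 0 <= P b - P a.
  move=> h0 hP; have [+ _] := hP a b 0 (lexx _) (ltW ab) (lexx _).
  by rewrite mul0r; apply => s /h0/andP[].
have F0 := ge0 _ _ uM uF; have G0 := ge0 _ _ vM vG; have H0 := ge0 _ _ wM wH.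
have step n : 0 < n <= 1 ->
    (F b - F a) * (G b - G a) <= (H b - H a + n) ^+ 2.
  (* With [e * (2 * M + 1) = n ^ 2] and [e <= 1], the product [(u + e) * (v + e)] is at most
     [u * v + n ^ 2], and [n ^ 2] is absorbed by [(w + n) ^ 2]. *)
  move=> /andP[n0 n1]; pose e := n ^+ 2 / (2 * M + 1).
  have M1 : 0 < 2 * M + 1 by rewrite ltr_wpDl// mulr_ge0.
  have e0 : 0 < e by rewrite divr_gt0// exprn_gt0.
  have eE : e * (2 * M + 1) = n ^+ 2 by rewrite divfK// gt_eqF.
  have e1 : e <= 1.
    by rewrite ler_pdivrMr//; move: n0 n1 M0; clear; nra.
  have := transport_1d a b R (M + 1) e (fun t => u t + e) (fun t => v t + e)
    (fun t => w t + n) (fun t => F t + e * t) (fun t => G t + e * t)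
    (fun t => H t + n * t) ab ba1 R1 e0.
  have le_base h (hM : forall s, a <= s <= b -> 0 <= h s <= M) s :
      a <= s <= b -> e <= h s + e <= M + 1.
    by move=> /hM; move: e1; clear; lra.
  move=> /(_ (le_base _ uM) (le_base _ vM)).
  have ne1 : forall s, a <= s <= b -> 0 <= w s + n <= M + 1.
    by move=> s /wM; move: n0 n1; clear; lra.
  move=> /(_ ne1).
  have c1 x s y : a <= x -> x <= s -> s <= y -> y <= b ->
      w x + n <= w s + n \/ w y + n <= w s + n.
    by move=> ax xs sy yb; rewrite !lerD2r; exact: wconc.
  have c2 x s y : a <= x -> x <= s -> s <= y -> y <= b ->
      w s + n <= R * (w x + n) \/ w s + n <= R * (w y + n).
    move=> ax xs sy yb; have nR : n <= R * n by rewrite ler_peMl// ltW.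
    by rewrite !mulrDr; have [h|h] := wquasi x s y ax xs sy yb; [left|right];
      exact: lerD.
  move=> /(_ c1 c2).
  have c3 x y : a <= x <= b -> a <= y <= b -> (u x + e) * (v y + e) <=
      (w ((x + y) / 2) + n) ^+ 2 * expR (2 / (9 * R) * (x - y) ^+ 2).
    move=> xab yab; set E := expR _.
    have E1 : 1 <= E.
      by rewrite -expR0 ler_expR mulr_ge0 ?sqr_ge0// divr_ge0// mulr_ge0// ltW.
    have := uvw x y xab yab; rewrite -/E.
    have : 0 <= w ((x + y) / 2) by apply: w0; move: xab yab; clear; lra.
    have := uM x xab; have := vM y yab; move: E1 n0 eE e0 e1.
    move: (u x) (v y) (w _) => p q r E1 n0 eE e0 e1 qM pM r0 pq.
    have k1 : (p + e) * (q + e) <= p * q + n ^+ 2.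
      by rewrite -eE; move: qM pM e0 e1; clear; nra.
    apply: le_trans k1 _.
    have k2 : n ^+ 2 <= n ^+ 2 * E by rewrite ler_peMr// sqr_ge0.
    apply: le_trans (lerD pq k2) _; rewrite -mulrDl ler_wpM2r ?(le_trans _ E1)//.
    by move: r0 n0; clear; nra.
  move=> /(_ c3 (mean_value_bounds_addC _ _ _ _ _ uF)
    (mean_value_bounds_addC _ _ _ _ _ vG) (mean_value_bounds_addC _ _ _ _ _ wH)).
  have ba0 : 0 < b - a by rewrite subr_gt0.
  have grow c P : P b + c * b - (P a + c * a) = P b - P a + c * (b - a).
    by clear; lra.
  rewrite !grow => T.
  have eb : 0 <= e * (b - a) by rewrite mulr_ge0// ltW.
  have l1 : (F b - F a) * (G b - G a) <=
      (F b - F a + e * (b - a)) * (G b - G a + e * (b - a)).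
    by rewrite ler_pM// lerDl.
  apply: le_trans l1 (le_trans T _).
  have nb : n * (b - a) <= n by rewrite ler_piMr// ltW.
  have nb0 : 0 <= n * (b - a) by rewrite mulr_ge0// ltW.
  have p0 := addr_ge0 H0 nb0; have q0 := addr_ge0 H0 (ltW n0).
  by rewrite ler_sqr ?nnegrE// lerD2l.
rewrite leNgt; apply/negP; set X := _ * _ => HX.
(* As [n <= 1], this gives [(I + n) ^ 2 < I ^ 2 + n * (2 * I + 2) <= X]. *)
pose I := H b - H a; pose n := Num.min 1 ((X - I ^+ 2) / (2 * I + 2)).
have I1 : 0 < 2 * I + 2 by rewrite ltr_wpDl// mulr_ge0.
have n0 : 0 < n by rewrite lt_min ltr01/= divr_gt0// subr_gt0.
have n1 : n <= 1 by rewrite ge_min lexx.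
have nX : n * (2 * I + 2) <= X - I ^+ 2.
  by rewrite -ler_pdivlMr// ge_min lexx orbT.
have := step n ltac:(by rewrite n0 n1); rewrite -/X -/I.
by move: nX n0 n1; clear; nra.
Qed.

(** * Boxes and marginals *)

Section boxes.
Context {K : realType}.

Definition rbox {n : nat} (a b : 'rV[K]_n) : set 'rV[K]_n :=
  [set x | forall i, a 0 i <= x 0 i <= b 0 i].

Definition tail_rV {n : nat} (a : 'rV[K]_n.+1) : 'rV[K]_n :=
  \row_i a 0 (lift ord0 i).

Lemma measurable_rbox n (a b : 'rV[K]_n) : measurable (rbox a b).
Proof.
rewrite (_ : rbox a b = \bigcap_(i in [set: 'I_n])
    (fun x : 'rV[K]_n => x 0 i) @^-1` `[a 0 i, b 0 i]); last first.
  apply/seteqP; split => x /= xab i.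
    by move=> _ /=; rewrite in_itv/= xab.
  by have := xab i Logic.I; rewrite /= in_itv.
apply: fin_bigcap_measurable => // i _.
by rewrite -[X in measurable X]setTI; exact: measurable_coord.
Qed.

Lemma lebesgue_rbox_fin n (a b : 'rV[K]_n) : (forall i, a 0 i <= b 0 i) ->
  (lebesgue_rV n (rbox a b) < +oo)%E.
Proof. by move=> ab; rewrite lebesgue_rV_box// ltry. Qed.

Lemma rbox_cons n (a b : 'rV[K]_n.+1) s y :
  rbox a b (cons_rV (s, y)) <->
  a 0 ord0 <= s <= b 0 ord0 /\ rbox (tail_rV a) (tail_rV b) y.
Proof.
split=> [ab|[sab yab] i].
  split=> [|i]; first by have := ab ord0; rewrite cons_rV0.
  by have := ab (lift ord0 i); rewrite cons_rVS !mxE.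
have [j ->|->] := unliftP ord0 i; last by rewrite cons_rV0.
by have := yab j; rewrite cons_rVS !mxE.
Qed.

Lemma cons_rV_comb n (l m s t : K) (x y : 'rV[K]_n) :
  l *: cons_rV (s, x) + m *: cons_rV (t, y) =
  cons_rV (l * s + m * t, l *: x + m *: y).
Proof.
apply/rowP => i; rewrite [LHS]mxE [X in X + _]mxE [X in _ + X]mxE.
have [j ->|->] := unliftP ord0 i; last by rewrite !cons_rV0.
by rewrite !cons_rVS [RHS]mxE [X in _ = X + _]mxE [X in _ = _ + X]mxE.
Qed.

Lemma cons_rV_mid n (s t : K) (x y : 'rV[K]_n) :
  2^-1 *: (cons_rV (s, x) + cons_rV (t, y)) =
  cons_rV ((s + t) / 2, 2^-1 *: (x + y)).
Proof. by rewrite !scalerDr cons_rV_comb mulrDl ![_ / 2]mulrC. Qed.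

Lemma axis_parallel_cons n (s : K) (x y : 'rV[K]_n) :
  axis_parallel (x - y) ->
  axis_parallel (cons_rV (s, x) - cons_rV (s, y)).
Proof.
move=> [i [c xy]]; exists (lift ord0 i), c.
rewrite -[cons_rV (s, x)]scale1r -scaleN1r cons_rV_comb scale1r scaleN1r xy.
rewrite mul1r mulN1r subrr; apply/rowP => j; rewrite [RHS]mxE [X in _ * X]mxE.
have [k ->|->] := unliftP ord0 j.
  by rewrite cons_rVS [LHS]mxE [X in _ * X = _]mxE (inj_eq lift_inj).
by rewrite cons_rV0 eq_liftF mulr0.
Qed.

(** Along such segments the slice variable is fixed, so integrating the [R]-convexity of [w] over it
    gives that of the marginal. *)
Lemma axis_parallel_cons0 n (s t : K) (x : 'rV[K]_n) :
  axis_parallel (cons_rV (s, x) - cons_rV (t, x)).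
Proof.
exists ord0, (s - t); rewrite -[cons_rV (s, x)]scale1r -scaleN1r cons_rV_comb.
rewrite scale1r scaleN1r subrr mul1r mulN1r.
apply/rowP => j; rewrite [RHS]mxE [X in _ * X]mxE.
have [k ->|->] := unliftP ord0 j.
  by rewrite cons_rVS [LHS]mxE eqxx [_ == ord0]eq_sym (negbTE (neq_lift _ _)) mulr0.
by rewrite cons_rV0 !eqxx mulr1.
Qed.

(* [measurable_cons_rV] equips the first factor with another display than the
   one [lebesgue_measure] lives on. *)
Lemma measurable_cons_lebesgue n :
  measurable_fun [set: measurableTypeR K * 'rV[K]_n] (@cons_rV K n).
Proof. by move=> _ Y mY; exact: (measurable_cons_rV measurableT mY). Qed.

Lemma measurable_slice n (h : 'rV[K]_n.+1 -> K) (s : K) :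
  measurable_fun setT h -> measurable_fun setT (fun y => h (cons_rV (s, y))).
Proof.
move=> mh.
apply: (measurableT_comp (f := h \o @cons_rV K n) (g := fun y => (s, y))).
  by apply: measurableT_comp => //; exact: measurable_cons_rV.
exact: pair1_measurable.
Qed.

Definition marginal {n : nat} (a b : 'rV[K]_n.+1) (h : 'rV[K]_n.+1 -> K)
    (s : K) : K :=
  \int[lebesgue_rV n]_(y in rbox (tail_rV a) (tail_rV b)) h (cons_rV (s, y)).

Section fubini.
Variables (n : nat) (a b : 'rV[K]_n.+1) (h : 'rV[K]_n.+1 -> K) (M : K).
Hypothesis ab : forall i, a 0 i <= b 0 i.
Hypothesis mh : measurable_fun setT h.
Hypothesis hM : forall x, 0 <= h x <= M.

Let tail_ab i : tail_rV a 0 i <= tail_rV b 0 i.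
Proof. by rewrite !mxE. Qed.

Lemma slice_integrable s :
  (lebesgue_rV n).-integrable (rbox (tail_rV a) (tail_rV b))
    (EFin \o fun y => h (cons_rV (s, y))).
Proof.
apply: (bounded_integrable _ _ _ _ M); first exact: measurable_rbox.
- exact: lebesgue_rbox_fin.
- exact: measurable_slice.
- by move=> y _; have /andP[h0 h1] := hM (cons_rV (s, y)); rewrite ger0_norm.
Qed.

(** The tail box enters as an indicator because Tonelli's theorem is applied on the whole product.
    The first coordinate is left free, so that one function serves for the measurability of the
    marginal and for the iterated integral. *)
Let box_fun (p : measurableTypeR K * 'rV[K]_n) : \bar K :=
  (h (cons_rV p) * \1_(rbox (tail_rV a) (tail_rV b)) p.2)%:E.

Let mbox_fun : measurable_fun setT box_fun.
Proof.
apply/measurable_EFinP; apply: measurable_funM.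
  by apply: measurableT_comp => //; exact: measurable_cons_lebesgue.
apply: measurableT_comp => //; apply: measurable_indic.
exact: measurable_rbox.
Qed.

Let box_fun_ge0 p : (0 <= box_fun p)%E.
Proof. by rewrite lee_fin mulr_ge0//; case/andP: (hM (cons_rV p)). Qed.

Let fubini_F_box (s : measurableTypeR K) :
  fubini_F (lebesgue_rV n) box_fun s = (marginal a b h s)%:E.
Proof.
rewrite /marginal /Rintegral fineK; last first.
  apply: integrable_fin_num; [exact: measurable_rbox|exact: slice_integrable].
rewrite [RHS]integral_mkcond; apply: eq_integral => y _.
by rewrite /box_fun patchE indicE/=; case: ifPn => _; rewrite ?mulr1 ?mulr0.
Qed.

Lemma measurable_marginal : measurable_fun setT (marginal a b h).
Proof.
apply/measurable_EFinP.
have -> : EFin \o marginal a b h = fubini_F (lebesgue_rV n) box_fun.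
  by apply/funext => s; rewrite fubini_F_box.
exact: measurable_fun_fubini_tonelli_F mbox_fun box_fun_ge0.
Qed.

Lemma marginal_bounds s :
  0 <= marginal a b h s <=
    M * fine (lebesgue_rV n (rbox (tail_rV a) (tail_rV b))).
Proof.
have mB := measurable_rbox _ (tail_rV a) (tail_rV b).
apply/andP; split.
  by apply: Rintegral_ge0 => y _; case/andP: (hM (cons_rV (s, y))).
rewrite -(Rintegral_cst _ mB); apply: le_Rintegral => //.
- exact: slice_integrable.
- apply: (bounded_integrable _ _ _ _ `|M|) => //; exact: lebesgue_rbox_fin.
- by move=> y _; case/andP: (hM (cons_rV (s, y))).
Qed.

Lemma Rintegral_rbox_cons :
  \int[lebesgue_rV n.+1]_(x in rbox a b) h x =
  \int[lebesgue_measure]_(s in `[a 0 ord0, b 0 ord0]) marginal a b h s.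
Proof.
rewrite /Rintegral; congr fine.
have mB := measurable_rbox _ a b.
have mh' : measurable_fun (rbox a b) (EFin \o h).
  by apply: measurable_funS (measurableT) _ _ => //; exact/measurable_EFinP.
have h0 : {in rbox a b, forall x, (0 <= (h x)%:E)%E}.
  by move=> x _; rewrite lee_fin; case/andP: (hM x).
pose leb2 : {measure set (measurableTypeR K * 'rV[K]_n) -> \bar K} :=
  (@lebesgue_measure K \x lebesgue_rV n)%E.
(* By construction, Lebesgue measure in dimension [n.+1] is the image of the product measure under
   [cons_rV]. *)
transitivity (\int[leb2]_(p in @cons_rV K n @^-1` rbox a b)
    ((EFin \o h) \o @cons_rV K n) p)%E.
  exact: (ge0_integral_pushforward (@measurable_cons_lebesgue n) leb2 mB mh' h0).
rewrite [RHS]integral_mkcond.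
pose g p := (box_fun p * (\1_(`[a 0 ord0, b 0 ord0]) p.1)%:E)%E.
transitivity (\int[leb2]_p g p)%E.
  rewrite (integral_mkcond (mu := leb2)).
  apply: eq_integral => -[s y] _; rewrite patchE /g /box_fun !indicE/=.
  have [/set_mem /rbox_cons[sab yab]|nab] := boolP ((s, y) \in _).
    by rewrite !mem_set//= ?mulr1 ?mule1// in_itv.
  have [ys|] := boolP (y \in _); last by rewrite mulr0 mul0e.
  have [ss|] := boolP (s \in _); last by rewrite mule0.
  case/negP: nab; apply/mem_set/rbox_cons; split; last exact: set_mem.
  by have := set_mem ss; rewrite /= in_itv.
have mg : measurable_fun setT g.
  apply: emeasurable_funM => //; apply/measurable_EFinP.
  by apply: measurableT_comp => //; apply: measurable_indic.
have g0 p : (0 <= g p)%E by rewrite mule_ge0// lee_fin.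
rewrite (fubini_tonelli1 g mg g0); apply: eq_integral => s _.
rewrite patchE /fubini_F /g/= indicE; case: ifPn => _.
  by rewrite -fubini_F_box; apply: eq_integral => y _; rewrite mule1.
by apply: integral0_eq => y _; rewrite mule0.
Qed.

End fubini.
End boxes.

(** * Property (tau) in dimension n *)

Definition axis_rconvex {K : realType} {n : nat} (R : K) (a b : 'rV[K]_n)
    (w : 'rV[K]_n -> K) :=
  forall x y l, 0 < l < 1 -> rbox a b x -> rbox a b y ->
    axis_parallel (x - y) ->
    w (l *: x + (1 - l) *: y) <= R * (l * w x + (1 - l) * w y).

(** [prekopa_1d] is applied to the marginals in the first coordinate; its midpoint and cost
    hypotheses are instances of the induction hypothesis on slices. *)
Lemma prekopa_rV {K : realType} (R : K) (n : nat) (M : K) (a b : 'rV[K]_n)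
    (u v w : 'rV[K]_n -> K) :
  1 <= R -> (forall i, a 0 i < b 0 i) -> (forall i, b 0 i - a 0 i <= 1) ->
  measurable_fun setT u -> measurable_fun setT v -> measurable_fun setT w ->
  (forall x, 0 <= u x <= M) -> (forall x, 0 <= v x <= M) ->
  (forall x, 0 <= w x <= M) ->
  axis_rconvex R a b w ->
  (forall x y, rbox a b x -> rbox a b y ->
     w x * w y <= w (2^-1 *: (x + y)) ^+ 2) ->
  (forall x y, rbox a b x -> rbox a b y ->
     u x * v y <= w (2^-1 *: (x + y)) ^+ 2 *
       expR (2 / (9 * R) * \sum_i (x 0 i - y 0 i) ^+ 2)) ->
  (\int[lebesgue_rV n]_(x in rbox a b) u x) *
  (\int[lebesgue_rV n]_(x in rbox a b) v x) <=
  (\int[lebesgue_rV n]_(x in rbox a b) w x) ^+ 2.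
Proof.
move=> R1; elim: n M a b u v w => [|n IH] M a b u v w.
  (* In dimension 0 the measure is a Dirac mass, and the claim is the cost hypothesis at the only
     point. *)
  move=> _ _ mu mv mw uM vM wM _ _ uvw.
  have int0 h : measurable_fun setT h ->
      \int[lebesgue_rV 0]_(x in rbox a b) h x = h 0.
    move=> mh; rewrite /Rintegral /= integral_dirac; last 2 first.
    - exact: measurable_rbox.
    - by apply: measurable_funS (measurableT) _ _ => //; exact/measurable_EFinP.
    by rewrite diracE mem_set ?mul1e// => -[].
  rewrite !int0//; have := uvw 0 0.
  rewrite big_ord0 mulr0 expR0 mulr1 addr0 scaler0; apply; by case.
move=> ab ba1 mu mv mw uM vM wM wR wmid uvw.
have R0 : 0 < R := lt_le_trans ltr01 R1.
have ab' i : a 0 i <= b 0 i by rewrite ltW.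
have tab i : tail_rV a 0 i < tail_rV b 0 i by rewrite !mxE.
have tba1 i : tail_rV b 0 i - tail_rV a 0 i <= 1 by rewrite !mxE.
rewrite (Rintegral_rbox_cons _ a b u M)// (Rintegral_rbox_cons _ a b v M)//.
rewrite (Rintegral_rbox_cons _ a b w M)//.
have mB := measurable_rbox _ (tail_rV a) (tail_rV b).
have intS h s mh hM := slice_integrable _ a b h M ab' mh hM s.
have cbox s x : a 0 ord0 <= s <= b 0 ord0 -> rbox (tail_rV a) (tail_rV b) x ->
    rbox a b (cons_rV (s, x)).
  by move=> sab xab; apply/rbox_cons.
have wRs s : a 0 ord0 <= s <= b 0 ord0 ->
    axis_rconvex R (tail_rV a) (tail_rV b) (fun x => w (cons_rV (s, x))).
  move=> sab x y l l01 xab yab xy.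
  have := wR _ _ l l01 (cbox s x sab xab) (cbox s y sab yab)
    (axis_parallel_cons _ s x y xy).
  by rewrite cons_rV_comb -mulrDl addrC subrK mul1r.
have wmids s t x y : a 0 ord0 <= s <= b 0 ord0 -> a 0 ord0 <= t <= b 0 ord0 ->
    rbox (tail_rV a) (tail_rV b) x -> rbox (tail_rV a) (tail_rV b) y ->
    w (cons_rV (s, x)) * w (cons_rV (t, y)) <=
    w (cons_rV ((s + t) / 2, 2^-1 *: (x + y))) ^+ 2.
  by move=> sab tab' xab yab; rewrite -cons_rV_mid; apply: wmid; exact: cbox.
have midab s t : a 0 ord0 <= s <= b 0 ord0 -> a 0 ord0 <= t <= b 0 ord0 ->
    a 0 ord0 <= (s + t) / 2 <= b 0 ord0.
  by clear; lra.
have expR1 (r : K) : 0 <= r -> 1 <= expR r.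
  by move=> r0; rewrite -[leLHS]expR0 ler_expR.
have midid (r : K) : (r + r) / 2 = r by clear; lra.
have k0 : 0 <= 2 / (9 * R) by rewrite divr_ge0// mulr_ge0// ltW.
apply: (prekopa_1d _ _ R (M * fine (lebesgue_rV n (rbox (tail_rV a) (tail_rV b))))).
- exact: ab.
- exact: ba1.
- exact: R1.
- exact: measurable_marginal mu uM.
- exact: measurable_marginal mv vM.
- exact: measurable_marginal mw wM.
- by move=> s _; exact: marginal_bounds.
- by move=> s _; exact: marginal_bounds.
- by move=> s _; exact: marginal_bounds.
(* Midpoint log-concavity of the marginal: the induction hypothesis for three slices of [w], as the
   exponential factor is at least 1. *)
- move=> s t sab tab'.
  apply: (IH M) => //; try exact: measurable_slice.
  + exact: wRs (midab s t sab tab').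
  + move=> x y xab yab; have := wmids _ _ x y (midab s t sab tab')
      (midab s t sab tab') xab yab.
    by rewrite midid.
  + move=> x y xab yab; apply: le_trans (wmids s t x y sab tab' xab yab) _.
    rewrite ler_peMr ?sqr_ge0//; apply: expR1; apply: mulr_ge0 => //.
    by apply: sumr_ge0 => i _; exact: sqr_ge0.
- move=> s t l sab tab' l01.
  have /andP[l0 l1] := l01.
  have stab : a 0 ord0 <= l * s + (1 - l) * t <= b 0 ord0.
    by move: sab tab' l0 l1; clear; nra.
  have i1 := intS w s mw wM; have i2 := intS w t mw wM.
  have i3 := intS w (l * s + (1 - l) * t) mw wM.
  have i1' : (lebesgue_rV n).-integrable (rbox (tail_rV a) (tail_rV b))
      (EFin \o (fun x => l * w (cons_rV (s, x)))).
    exact: (integrableZl mB l i1).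
  have i2' : (lebesgue_rV n).-integrable (rbox (tail_rV a) (tail_rV b))
      (EFin \o (fun x => (1 - l) * w (cons_rV (t, x)))).
    exact: (integrableZl mB (1 - l) i2).
  have i12 : (lebesgue_rV n).-integrable (rbox (tail_rV a) (tail_rV b))
      (EFin \o (fun x => l * w (cons_rV (s, x)) + (1 - l) * w (cons_rV (t, x)))).
    exact: (integrableD mB i1' i2').
  rewrite /marginal -!RintegralZl// -RintegralD// -RintegralZl//.
  apply: le_Rintegral => //; first exact: (integrableZl mB R i12).
  move=> x xab; have := wR _ _ l l01 (cbox s x sab xab) (cbox t x tab' xab)
    (axis_parallel_cons0 _ s t x).
  have -> : l *: cons_rV (s, x) + (1 - l) *: cons_rV (t, x) =
      cons_rV (l * s + (1 - l) * t, x).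
    by rewrite cons_rV_comb -scalerDl (addrC l) subrK scale1r.
  by [].
move=> s t sab tab'.
(* The quadratic cost splits over the coordinates. The share of the first one is [c ^ 2], and goes
   into the slice of [w] as a factor [c]; both shape conditions on [w] are homogeneous. *)
pose c := expR ((9 * R)^-1 * (s - t) ^+ 2).
have c2 : c ^+ 2 = expR (2 / (9 * R) * (s - t) ^+ 2).
  by rewrite /c -expRM_natl !mulrA.
have c0 : 0 < c := expR_gt0 _.
have c1 : 1 <= c.
  by rewrite expR1// mulr_ge0 ?sqr_ge0// invr_ge0 mulr_ge0// ltW.
rewrite -c2 -exprMn.
have -> : marginal a b w ((s + t) / 2) * c =
    \int[lebesgue_rV n]_(x in rbox (tail_rV a) (tail_rV b))
      (w (cons_rV ((s + t) / 2, x)) * c).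
  by rewrite /marginal -RintegralZr//; exact: intS.
have le_Mc r : 0 <= r <= M -> 0 <= r <= M * c.
  by move=> /andP[h0 h1]; rewrite h0 (le_trans h1)// ler_peMr// (le_trans h0).
apply: (IH (M * c)) => //; try exact: measurable_slice.
- by apply: measurable_funM => //; exact: measurable_slice.
- by move=> x; apply: le_Mc.
- by move=> x; apply: le_Mc.
- by move=> x; have /andP[h0 h1] := wM (cons_rV ((s + t) / 2, x));
    rewrite mulr_ge0 ?ler_wpM2r// ltW.
- move=> x y l l01 xab yab xy.
  have := wRs _ (midab s t sab tab') x y l l01 xab yab xy.
  rewrite -(ler_pM2r c0) => /le_trans; apply.
  by rewrite le_eqVlt; apply/orP; left; apply/eqP; ring.
- move=> x y xab yab; have := wmids _ _ x y (midab s t sab tab')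
      (midab s t sab tab') xab yab.
  rewrite midid => H.
  by rewrite mulrACA exprMn -expr2 ler_wpM2r// sqr_ge0.
- move=> x y xab yab; rewrite exprMn c2 -[leRHS]mulrA -expRD -mulrDr.
  have := uvw _ _ (cbox s x sab xab) (cbox t y tab' yab).
  rewrite cons_rV_mid big_ord_recl !cons_rV0.
  by under eq_bigr do rewrite !cons_rVS.
Qed.

(** * Concentration *)

Lemma rbox_convex {K : realType} {n : nat} (a b x y : 'rV[K]_n) (l : K) :
  0 <= l <= 1 -> rbox a b x -> rbox a b y -> rbox a b (l *: x + (1 - l) *: y).
Proof.
move=> l01 xab yab i; rewrite !mxE.
by have := xab i; have := yab i; move: l01; clear; nra.
Qed.

Lemma rbox_mid {K : realType} {n : nat} (a b x y : 'rV[K]_n) :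
  rbox a b x -> rbox a b y -> rbox a b (2^-1 *: (x + y)).
Proof.
move=> xab yab i; rewrite !mxE.
by have := xab i; have := yab i; clear; lra.
Qed.

(** A point of the box lies on a segment along the first axis between two opposite faces, where [f]
    is bounded by induction; [R]-convexity on this segment does the rest. Such a bound is required
    by [prekopa_rV]. *)
Lemma axis_rconvex_bounded {K : realType} (R : K) (n : nat) (a b : 'rV[K]_n)
    (f : 'rV[K]_n -> K) :
  1 <= R -> (forall i, a 0 i < b 0 i) -> (forall x, 0 <= f x) ->
  axis_rconvex R a b f -> exists M, forall x, rbox a b x -> f x <= M.
Proof.
move=> R1; elim: n a b f => [|n IH] a b f ab f0 fR.
  by exists (f 0) => x _; rewrite (_ : x = 0)//; apply/rowP => -[].
have tab i : tail_rV a 0 i < tail_rV b 0 i by rewrite !mxE.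
have slice s : a 0 ord0 <= s <= b 0 ord0 ->
    axis_rconvex R (tail_rV a) (tail_rV b) (fun x => f (cons_rV (s, x))).
  move=> sab x y l l01 xab yab xy.
  have xab' : rbox a b (cons_rV (s, x)) by apply/rbox_cons.
  have yab' : rbox a b (cons_rV (s, y)) by apply/rbox_cons.
  have := fR _ _ l l01 xab' yab' (axis_parallel_cons _ s x y xy).
  by rewrite cons_rV_comb -mulrDl (addrC l) subrK mul1r.
have a0 : a 0 ord0 <= a 0 ord0 <= b 0 ord0 by rewrite lexx ltW.
have b0 : a 0 ord0 <= b 0 ord0 <= b 0 ord0 by rewrite lexx ltW.
have [Ma fMa] := IH _ _ _ tab (fun x => f0 _) (slice _ a0).
have [Mb fMb] := IH _ _ _ tab (fun x => f0 _) (slice _ b0).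
exists (R * (Ma + Mb)) => x.
pose s := x 0 ord0; pose y := tail_rV x.
have -> : x = cons_rV (s, y).
  apply/rowP => i; have [j ->|->] := unliftP ord0 i; last by rewrite cons_rV0.
  by rewrite cons_rVS mxE.
move=> /rbox_cons[sab yab].
have fa := fMa y yab; have fb := fMb y yab.
have fa0 := f0 (cons_rV (a 0 ord0, y)); have fb0 := f0 (cons_rV (b 0 ord0, y)).
have [->|sa] := eqVneq s (a 0 ord0).
  by move: fa fb fa0 fb0 R1; clear; nra.
have [->|sb] := eqVneq s (b 0 ord0).
  by move: fa fb fa0 fb0 R1; clear; nra.
have /andP[as_ sb_] := sab.
have {}sa : a 0 ord0 < s by rewrite lt_neqAle eq_sym sa.
have {}sb : s < b 0 ord0 by rewrite lt_neqAle sb.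
have ba : 0 < b 0 ord0 - a 0 ord0 by rewrite subr_gt0.
pose l := (b 0 ord0 - s) / (b 0 ord0 - a 0 ord0).
have l01 : 0 < l < 1.
  apply/andP; split; first by apply: divr_gt0 => //; rewrite subr_gt0.
  by rewrite ltr_pdivrMr// mul1r; move: sa; clear; lra.
have yab1 : rbox a b (cons_rV (a 0 ord0, y)) by apply/rbox_cons.
have yab2 : rbox a b (cons_rV (b 0 ord0, y)) by apply/rbox_cons.
have := fR _ _ l l01 yab1 yab2 (axis_parallel_cons0 _ _ _ _).
have -> : l *: cons_rV (a 0 ord0, y) + (1 - l) *: cons_rV (b 0 ord0, y) =
    cons_rV (s, y).
  rewrite cons_rV_comb -scalerDl (addrC l) subrK scale1r; congr (cons_rV (_, _)).
  by rewrite /l; field; rewrite gt_eqF.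
move=> /le_trans; apply; rewrite ler_wpM2l ?(le_trans _ R1)//.
by move: l01 fa fb fa0 fb0; clear; nra.
Qed.

Lemma log_concave_mid {K : realType} {n : nat} (f : 'rV[K]_n -> K) x y :
  log_concave f -> f x * f y <= f (2^-1 *: (x + y)) ^+ 2.
Proof.
move=> [f0 flc].
have [fx0|fx0] := eqVneq (f x) 0; first by rewrite fx0 mul0r sqr_ge0.
have [fy0|fy0] := eqVneq (f y) 0; first by rewrite fy0 mulr0 sqr_ge0.
have {}fx0 : 0 < f x by rewrite lt_neqAle eq_sym fx0 f0.
have {}fy0 : 0 < f y by rewrite lt_neqAle eq_sym fy0 f0.
have l01 : 0 < (2^-1 : K) < 1 by lra.
have := flc x y _ l01.
have -> : 1 - 2^-1 = 2^-1 :> K by lra.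
rewrite -scalerDr (lne_EFin fx0) (lne_EFin fy0).
(* If [f] vanished at the midpoint, the left-hand side would be [+oo] and the right-hand side
   finite. *)
have [m0|m0] := eqVneq (f (2^-1 *: (x + y))) 0.
  by rewrite m0 /= lexx.
have {}m0 : 0 < f (2^-1 *: (x + y)) by rewrite lt_neqAle eq_sym m0 f0.
rewrite (lne_EFin m0) lee_fin => H.
rewrite -ler_ln ?posrE ?mulr_gt0 ?exprn_gt0// lnM ?posrE// lnXn// mulr2n.
by move: H; clear; lra.
Qed.

Lemma box_concentration {K : realType} {n : nat} (R t : K) (a b : 'rV[K]_n)
    (mu : probability 'rV[K]_n K) (f : 'rV[K]_n -> K) (A B : set 'rV[K]_n) :
  1 <= R -> (forall i, a 0 i < b 0 i) -> (forall i, b 0 i - a 0 i <= 1) ->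
  has_density mu f -> log_concave f -> axis_rconvex R a b f ->
  measurable A -> measurable B ->
  (forall x y, A x -> B y -> t ^+ 2 <= \sum_i (x 0 i - y 0 i) ^+ 2) ->
  expR (2 / (9 * R) * t ^+ 2) *
    (fine (mu (rbox a b `&` A)) * fine (mu (rbox a b `&` B))) <= 1.
Proof.
move=> R1 ab ba1 [mf muf] flc fR mA mB ABt.
have [f0 _] := flc; have R0 : 0 < R := lt_le_trans ltr01 R1.
have [M0 fM0] := axis_rconvex_bounded R n a b f R1 ab f0 fR.
pose M := `|M0|.
have M_ge0 : 0 <= M := normr_ge0 _.
have mbox := measurable_rbox _ a b.
(* [prekopa_rV] asks for global bounds, while [f] is known to be bounded on the box only. *)
pose F x := f x * \1_(rbox a b) x.
have FE x : rbox a b x -> F x = f x by move=> xab; rewrite /F indicE mem_set// mulr1.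
have F0 x : 0 <= F x by rewrite mulr_ge0.
have FM x : F x <= M.
  rewrite /F indicE; have [/set_mem xab|_] := boolP (x \in _); last by rewrite mulr0.
  by rewrite mulr1 (le_trans (fM0 x xab))// ler_norm.
have mF : measurable_fun setT F.
  by apply: measurable_funM => //; apply: measurable_indic.
pose k := 2 / (9 * R); have k0 : 0 <= k by rewrite divr_ge0// mulr_ge0// ltW.
(* For [x] in [A] and [y] in [B] the squared distance is at least [t ^ 2], which leaves room for the
   factor [c] on [v]. *)
pose c := expR (k * t ^+ 2).
have c1 : 1 <= c by rewrite -[leLHS]expR0 ler_expR mulr_ge0// sqr_ge0.
have c0 : 0 < c by exact: expR_gt0.
pose u x := F x * \1_A x; pose v x := F x * \1_B x.
have mu_ : measurable_fun setT u by apply: measurable_funM => //; apply: measurable_indic.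
have mv : measurable_fun setT v by apply: measurable_funM => //; apply: measurable_indic.
have part S : measurable S ->
    \int[lebesgue_rV n]_(x in rbox a b) (F x * \1_S x) =
    fine (mu (rbox a b `&` S)).
  move=> mS; rewrite muf; last exact: measurableI.
  rewrite /Rintegral integral_mkcondr; congr fine.
  apply: eq_integral => x /set_mem xab; rewrite patchE FE// indicE.
  by case: ifPn => _; rewrite ?mulr1 ?mulr0.
have whole : \int[lebesgue_rV n]_(x in rbox a b) F x = fine (mu (rbox a b)).
  by rewrite -[rbox a b in RHS]setIT -part//; apply: eq_Rintegral => x _;
    rewrite indicT mulr1.
have FMc x : 0 <= F x <= M * c.
  by rewrite F0 (le_trans (FM x))// ler_peMr.
have FSM (S : set 'rV[K]_n) x : 0 <= F x * \1_S x <= M.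
  by rewrite indicE; case: (x \in S); rewrite ?mulr1 ?mulr0 ?F0 ?FM ?lexx.
have := prekopa_rV R n (M * c) a b u (fun x => v x * c) F R1 ab ba1 mu_.
have mvc : measurable_fun setT (fun x => v x * c) by apply: measurable_funM.
move=> /(_ mvc mF).
have uM x : 0 <= u x <= M * c.
  by have /andP[h0 h1] := FSM A x; rewrite h0 (le_trans h1)// ler_peMr.
have vM x : 0 <= v x * c <= M * c.
  by have /andP[h0 h1] := FSM B x; rewrite mulr_ge0 ?ler_pM2r// ltW.
move=> /(_ uM vM FMc).
have FR : axis_rconvex R a b F.
  move=> x y l l01 xab yab xy; rewrite !FE//; first exact: fR.
  by apply: rbox_convex => //; case/andP: l01 => /ltW -> /ltW ->.
have Fmid x y : rbox a b x -> rbox a b y ->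
    F x * F y <= F (2^-1 *: (x + y)) ^+ 2.
  move=> xab yab; rewrite !FE//; first exact: log_concave_mid.
  exact: rbox_mid.
have uvF x y : rbox a b x -> rbox a b y ->
    u x * (v y * c) <= F (2^-1 *: (x + y)) ^+ 2 *
      expR (k * \sum_i (x 0 i - y 0 i) ^+ 2).
  move=> xab yab; have r0 : 0 <= F (2^-1 *: (x + y)) ^+ 2 *
      expR (k * \sum_i (x 0 i - y 0 i) ^+ 2) by rewrite mulr_ge0 ?sqr_ge0 ?expR_ge0.
  rewrite /u /v !indicE; have [/set_mem xA|_] := boolP (x \in A); last first.
    by rewrite mulr0 mul0r.
  have [/set_mem yB|_] := boolP (y \in B); last by rewrite mulr0 mul0r mulr0.
  rewrite !mulr1 mulrA ler_pM ?mulr_ge0 ?(ltW c0)//; first exact: Fmid.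
  by rewrite ler_expR ler_wpM2l// ABt.
move=> /(_ FR Fmid uvF).
have iv : (lebesgue_rV n).-integrable (rbox a b) (EFin \o v).
  apply: (bounded_integrable _ _ _ _ M) => //.
    by apply: lebesgue_rbox_fin => i; exact: ltW.
  by move=> x _; have /andP[h0 h1] := FSM B x; rewrite ger0_norm.
rewrite RintegralZr// !part// whole => H.
rewrite [leLHS]mulrC -[leLHS]mulrA; apply: le_trans H _.
rewrite expr_le1//; last exact: fine_ge0.
rewrite -lee_fin fineK ?fin_num_measure//; exact: probability_le1.
Qed.

(** A closed cube is itself such a box. An open one is an increasing union of closed boxes, and
    continuity of [mu] from below yields one that misses mass at most [e]. Staying inside [Q] keeps
    the [R]-convexity of the density available. *)
Lemma unit_cube_boxes {K : realType} {n : nat} (Q : set 'rV[K]_n)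
    (mu : probability 'rV[K]_n K) (e : K) :
  unit_cube Q -> mu (~` Q) = 0%E -> 0 < e ->
  exists a b : 'rV[K]_n, [/\ forall i, a 0 i < b 0 i,
    forall i, b 0 i - a 0 i <= 1, rbox a b `<=` Q &
    ((1 - e)%:E <= mu (rbox a b))%E].
Proof.
move=> [c QE] Q0 e0.
have muQ : measurable Q -> mu Q = 1%E.
  by move=> mQ; rewrite -[Q]setCK probability_setC ?Q0 ?sube0//; exact: measurableC.
case: QE => QE; last first.
  have {}QE : Q = rbox c (c + const_mx 1).
    rewrite QE; apply/seteqP; split => [_ [u u01 <-] i|x xc].
      by have := u01 i; rewrite !mxE; clear; lra.
    exists (x - c); last by rewrite addrC subrK.
    by move=> i; have := xc i; rewrite !mxE; clear; lra.
  exists c, (c + const_mx 1); rewrite -QE; split => //.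
  - by move=> i; rewrite !mxE ltrDl.
  - by move=> i; rewrite !mxE; clear; lra.
  by rewrite muQ ?lee_fin ?gerBl ?(ltW e0)// QE; exact: measurable_rbox.
(* The margin is at most 1/3, so the boxes have positive side [1 - 2 * d k]. *)
pose d k : K := k.+3%:R^-1.
have d0 k : 0 < d k by rewrite invr_gt0 ltr0n.
have d3 k : d k <= 3^-1 by rewrite lef_pV2 ?posrE ?ltr0n// ler_nat.
pose B k := rbox (c + const_mx (d k)) (c + const_mx (1 - d k)).
have QB : Q = \bigcup_k B k.
  rewrite QE; apply/seteqP; split => [_ [u u01 <-]|x [k _ xB]]; last first.
    exists (x - c); last by rewrite addrC subrK.
    by move=> i; have := xB i; have := d0 k; rewrite !mxE; clear; lra.
  have ki i : exists k, d k <= u 0 i <= 1 - d k.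
    have /andP[u0 u1] := u01 i.
    pose m := Num.min (u 0 i) (1 - u 0 i).
    have m0 : 0 < m by rewrite lt_min u0 subr_gt0.
    have mi : 0 <= m^-1 by rewrite invr_ge0 ltW.
    have := archi_boundP mi; set k := Num.Def.archi_bound _ => mk.
    have dm : d k <= m.
      rewrite /d -[leRHS]invrK lef_pV2 ?posrE ?invr_gt0 ?ltr0n//.
      by rewrite (le_trans (ltW mk))// ler_nat; nat_lia.
    exists k; move: dm; rewrite le_min => /andP[-> h] /=.
    by move: h; clear; lra.
  have [kk kkP] := choice ki.
  (* There are finitely many coordinates, so the largest of their indices serves for all. *)
  exists (\max_i kk i)%N => // i; have := kkP i; rewrite !mxE.
  have : d (\max_i kk i)%N <= d (kk i).
    by rewrite lef_pV2 ?posrE ?ltr0n// ler_nat !ltnS leq_bigmax.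
  by clear; lra.
have mB k : measurable (B k) := measurable_rbox _ _ _.
have mQ : measurable Q by rewrite QB; exact: bigcupT_measurable.
have ndB : nondecreasing_seq B.
  move=> k l kl; apply/subsetPset => x xB i; have := xB i; rewrite !mxE.
  have : d l <= d k by rewrite lef_pV2 ?posrE ?ltr0n// ler_nat !ltnS.
  by clear; lra.
have cvgB : mu (B k) @[k --> \oo] --> mu Q.
  by rewrite QB; apply: nondecreasing_cvg_mu => //; rewrite -QB.
have [k Bk] : exists k, ((1 - e)%:E <= mu (B k))%E.
  apply: contrapT => nex.
  have : (lim (mu (B k) @[k --> \oo]) <= (1 - e)%:E)%E.
    apply: lime_le; first by apply/cvg_ex; exists (mu Q).
    apply: nearW => k; rewrite leNgt; apply/negP => /ltW H.
    by apply: nex; exists k.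
  by rewrite (cvg_lim _ cvgB)// muQ// lee_fin; move: e0; clear; lra.
exists (c + const_mx (d k)), (c + const_mx (1 - d k)); split => //.
- by move=> i; have := d3 k; rewrite !mxE; clear; lra.
- by move=> i; have := d0 k; rewrite !mxE; clear; lra.
by rewrite QB => x xB; exists k.
Qed.

Lemma continuous_sqdist {K : realType} {n : nat} (a : 'rV[K]_n) :
  continuous (fun x : 'rV[K]_n => \sum_i (x 0 i - a 0 i) ^+ 2).
Proof.
apply: (@continuous_big _ _ _ _ predT).
  exact: add_continuous.
move=> i _ x.
have h : (fun y : 'rV[K]_n => y 0 i - a 0 i) y @[y --> x] --> x 0 i - a 0 i.
  have ci : (fun y : 'rV[K]_n => y 0 i) y @[y --> x] --> x 0 i.
    exact: (@coord_continuous K 1 n 0 i x).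
  exact: (cvgB ci (cvg_cst (a 0 i))).
exact: (cvgM h h).
Qed.

(** A union of open balls is Borel whatever [A] is: this is the measurable subset of [thicken A t]
    that bounds the inner measure from below. By the strict inequality, its complement keeps
    distance at least [t] from [A]. *)
Lemma open_near {K : realType} {n : nat} (A : set 'rV[K]_n) (t : K) :
  open [set x : 'rV[K]_n | exists2 a, A a & \sum_i (x 0 i - a 0 i) ^+ 2 < t ^+ 2].
Proof.
rewrite (_ : mkset _ = \bigcup_(a in A)
    (fun x : 'rV[K]_n => \sum_i (x 0 i - a 0 i) ^+ 2) @^-1` [set r : K | r < t ^+ 2]).
  apply: bigcup_open => a _; apply: open_comp; last exact: open_lt.
  by move=> x _; exact: continuous_sqdist.
by apply/seteqP; split => x [a Aa xa]; exists a.
Qed.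

Lemma near_sub_thicken {K : realType} {n : nat} (A : set 'rV[K]_n) (t : K) :
  0 < t ->
  [set x : 'rV[K]_n | exists2 a, A a & \sum_i (x 0 i - a 0 i) ^+ 2 < t ^+ 2] `<=`
  thicken A t.
Proof.
move=> t0 x [a Aa xa]; exists a => //; exists (t^-1 *: (x - a)); last first.
  by rewrite scalerA divff ?gt_eqF// scale1r addrC subrK.
rewrite /eball /= /enorm -[leRHS]sqrtr1 ler_wsqrtr//.
have -> : \sum_i (t^-1 *: (x - a)) 0 i ^+ 2 =
    t ^- 2 * \sum_i (x 0 i - a 0 i) ^+ 2.
  by rewrite mulr_sumr; apply: eq_bigr => i _; rewrite !mxE exprMn exprVn.
by rewrite mulrC ler_pdivrMr ?exprn_gt0// mul1r ltW.
Qed.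

(** Restriction to a box missing mass at most [e] lowers [mu A] and [mu B] by at most [e] each,
    hence their product by at most [3 * e]; then [e] tends to 0. *)
Lemma separated_measures {K : realType} {n : nat} (R t : K) (Q : set 'rV[K]_n)
    (mu : probability 'rV[K]_n K) (f : 'rV[K]_n -> K) (A B : set 'rV[K]_n) :
  1 <= R -> unit_cube Q -> mu (~` Q) = 0%E -> has_density mu f ->
  log_concave f ->
  (forall (x y : 'rV[K]_n) (l : K), 0 < l < 1 -> Q x -> Q y ->
     axis_parallel (x - y) ->
     f (l *: x + (1 - l) *: y) <= R * (l * f x + (1 - l) * f y)) ->
  measurable A -> measurable B ->
  (forall x y, A x -> B y -> t ^+ 2 <= \sum_i (x 0 i - y 0 i) ^+ 2) ->
  expR (2 / (9 * R) * t ^+ 2) * (fine (mu A) * fine (mu B)) <= 1.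
Proof.
move=> R1 Qc Q0 muf flc fR mA mB ABt.
set c := expR _; have c0 : 0 < c := expR_gt0 _.
have approx e : 0 < e -> e <= 1 ->
    c * (fine (mu A) * fine (mu B)) <= 1 + 3 * c * e.
  move=> e0 e1; have [a [b [ab ba1 abQ mub]]] := unit_cube_boxes Q mu e Qc Q0 e0.
  have fR' : axis_rconvex R a b f.
    by move=> x y l l01 xab yab; apply: fR => //; exact: abQ.
  have := box_concentration R t a b mu f A B R1 ab ba1 muf flc fR' mA mB ABt.
  rewrite -/c.
  have mbox := measurable_rbox _ a b.
  have mubox : 1 - e <= fine (mu (rbox a b)).
    by rewrite -lee_fin fineK// fin_num_measure.
  have split_mu S : measurable S ->
      0 <= fine (mu (rbox a b `&` S)) <= 1 /\
      fine (mu S) <= fine (mu (rbox a b `&` S)) + e.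
    move=> mS; have mI : measurable (rbox a b `&` S) by exact: measurableI.
    have p1 T : measurable T -> fine (mu T) <= 1.
      move=> mT; rewrite -lee_fin fineK ?fin_num_measure//.
      exact: probability_le1.
    split; first by rewrite fine_ge0//= p1.
    have SE : mu S = (mu (rbox a b `&` S) + mu (S `\` rbox a b))%E.
      rewrite setIC -measureU//; first by rewrite setUIDK.
      - exact: measurableI.
      - exact: measurableD.
      - by apply/seteqP; split => x // [[_ xab] [_ /(_ xab)]].
    have mD : measurable (S `\` rbox a b) by exact: measurableD.
    rewrite SE fineD ?fin_num_measure// lerD2l.
    have mC : measurable (~` rbox a b) by exact: measurableC.
    have : (mu (S `\` rbox a b) <= mu (~` rbox a b))%E.
      by apply: le_measure; rewrite ?inE// => x [].
    move=> /(fine_le _ _); rewrite !fin_num_measure// => /(_ isT isT).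
    move=> /le_trans; apply.
    rewrite probability_setC// fineB ?fin_num_measure//=.
    by move: mubox; clear; lra.
  have [/andP[pA0 pA1] pAe] := split_mu A mA.
  have [/andP[pB0 pB1] pBe] := split_mu B mB.
  have pA : 0 <= fine (mu A) by exact: fine_ge0.
  have pB : 0 <= fine (mu B) by exact: fine_ge0.
  move: pA pB pA0 pA1 pB0 pB1 pAe pBe.
  move: (fine (mu A)) (fine (mu B)) (fine (mu (_ `&` A))) (fine (mu (_ `&` B))).
  move=> x y x' y' x0 y0 x'0 x'1 y'0 y'1 xx' yy' H.
  have xy : x * y <= x' * y' + 3 * e.
    by move: x0 y0 x'0 x'1 y'0 y'1 xx' yy' e0 e1; clear; nra.
  have := ler_wpM2l (ltW c0) xy; move: H; clear; lra.
rewrite leNgt; apply/negP => H.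
pose X := c * (fine (mu A) * fine (mu B)).
(* This choice gives [1 + 3 * c * e <= 1 + (X - 1) / 2 < X]. *)
pose e := Num.min 1 ((X - 1) / (6 * c)).
have e0 : 0 < e.
  by rewrite lt_min ltr01/=; apply: divr_gt0; rewrite ?mulr_gt0// subr_gt0.
have := approx e e0 ltac:(by rewrite ge_min lexx); rewrite -/X.
have : e * (6 * c) <= X - 1.
  by rewrite -ler_pdivlMr ?mulr_gt0// ge_min lexx orbT.
by move: H; rewrite -/X; clear; lra.
Qed.

Theorem theorem1p2 (K : realType) (n : nat) (R : K) (Q : set 'rV[K]_n)
    (mu : probability 'rV[K]_n K) (f : 'rV[K]_n -> K) (A : set 'rV[K]_n)
    (R_ge1 : 1 <= R)
    (Q_cube : unit_cube Q)
    (mu_supp : mu (~` Q) = 0%E)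
    (f_density : has_density mu f)
    (f_log_concave : log_concave f)
    (f_Rconvex : forall (x y : 'rV[K]_n) (l : K), 0 < l < 1 -> Q x -> Q y ->
       axis_parallel (x - y) ->
       f (l *: x + (1 - l) *: y) <= R * (l * f x + (1 - l) * f y))
    (A_measurable : measurable A)
    (A_half : ((2^-1)%:E <= mu A)%E) :
  let alpha := 3 * R in
  forall t : K, 0 < t ->
    ((1 - expR (- (t ^+ 2 / alpha ^+ 2)))%:E <= inner_measure mu (thicken A t))%E.
Proof.
move=> alpha t t0.
have R0 : 0 < R := lt_le_trans ltr01 R_ge1.
have inner C : measurable C -> C `<=` thicken A t ->
    (mu C <= inner_measure mu (thicken A t))%E.
  by move=> mC CA; apply: ereal_sup_ubound; exists C.
set k := t ^+ 2 / alpha ^+ 2.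
have E0 := expR_gt0 k.
(* When [expR k <= 2] the claimed bound is at most 1/2, and the subset [A] of [thicken A t]
   suffices. *)
have [E2|E2] := leP (expR k) 2.
  apply: le_trans (inner A A_measurable _); last first.
    move=> x Ax; exists x => //; exists 0; last by rewrite scaler0 addr0.
    rewrite /eball /= /enorm big1 ?sqrtr0// => i _.
    by rewrite mxE expr0n.
  apply: le_trans A_half; rewrite lee_fin expRN.
  have : 2^-1 <= (expR k)^-1 by rewrite lef_pV2 ?posrE.
  by clear; lra.
pose C := [set x : 'rV[K]_n |
  exists2 a, A a & \sum_i (x 0 i - a 0 i) ^+ 2 < t ^+ 2].
have mC : measurable C by apply: sub_sigma_algebra; exact: open_near.
apply: le_trans (inner C mC (near_sub_thicken A t t0)).
have sep x y : A x -> (~` C) y -> t ^+ 2 <= \sum_i (x 0 i - y 0 i) ^+ 2.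
  move=> Ax Cy; rewrite leNgt; apply/negP => xy; apply: Cy; exists x => //.
  by under eq_bigr do rewrite -opprB sqrrN.
have mC' : measurable (~` C) by exact: measurableC.
have := separated_measures R t Q mu f A (~` C) R_ge1 Q_cube mu_supp f_density
  f_log_concave f_Rconvex A_measurable mC' sep.
(* As [alpha = 3 * R], the exponent is [2 * R * k], and [R >= 1] makes the exponential at least
   [expR k ^ 2]. *)
have -> : 2 / (9 * R) * t ^+ 2 = 2 * R * k.
  by rewrite /k /alpha; field; rewrite gt_eqF.
have k0 : 0 <= k by rewrite divr_ge0// sqr_ge0.
have Ek : expR k ^+ 2 <= expR (2 * R * k).
  rewrite -expRM_natl ler_expR ler_wpM2r// ler_peMr//.
have pA : 2^-1 <= fine (mu A) by rewrite -lee_fin fineK ?fin_num_measure.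
have pC : mu C = (1 - fine (mu (~` C)))%:E.
  by rewrite -[C in LHS]setCK probability_setC// EFinB fineK// fin_num_measure.
have p0 : 0 <= fine (mu (~` C)) by exact: fine_ge0.
rewrite pC lee_fin lerD2l lerN2 expRN.
move: Ek pA p0; move: (fine (mu A)) (fine (mu (~` C))) (expR (2 * R * k)).
move=> x p G EG x2 p0 H.
(* From [E ^ 2 * x * p <= 1], [x >= 1/2] and [E > 2] one gets [p * E <= p * E ^ 2 / 2 <= 1]; the two
   inequalities come from [h2] and from [h3] with [h1]. *)
rewrite -div1r ler_pdivlMr//; move: E2 E0 EG; move: (expR k) => E E2 E0 EG.
have xp0 : 0 <= x * p by rewrite mulr_ge0// (le_trans _ x2)// invr_ge0.
have h1 := le_trans (ler_wpM2r xp0 EG) H.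
have h2 : 0 <= p * E * (E - 2).
  by apply: mulr_ge0; [rewrite mulr_ge0// ltW|rewrite subr_ge0 ltW].
have h3 : 0 <= p * E ^+ 2 * (x - 2^-1).
  by apply: mulr_ge0; [rewrite mulr_ge0// sqr_ge0|rewrite subr_ge0].
by move: h1 h2 h3; clear; lra.
Qed.
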